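(* Let $F(Z) = \sum_{N \geq0} a(N) \exp \left({2 \pi i} \, \textup{Tr}(NZ) \right) \in M_k^2(\Gamma)$ be an eigenform, normalized with $a(I)=1$. Let $$h_1(p) = \begin{cases} 2 & \textup{ if } p \equiv 1 \pmod{4}\\ 1 & \textup{ if } p=2\\ 0 & \textup{ if } p \equiv 3 \pmod{4}, \end{cases} \quad \textup{and} \quad h_2(p) = \begin{cases} 2 & \textup{ if } p \equiv 1 \pmod{4}\\ 0 & \textup{ if } p=2 \textup{ or }p \equiv 3 \pmod{4}. \end{cases}$$ Then for any prime $p$, the eigenvalues of index $p$ and $p^2$ associated to $F$ satisfy $$\lambda_F(p) = a(pI) + h_1(p) \,p^{k-2}$$ and $$\lambda_F(p^2) = a(p^2I) + h_1(p) \, p^{k-2} \, a(pI) + h_2(p) \, p^{2k-4}.$$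
   Context: $M_k^2(\Gamma)$ denotes the space of Siegel modular forms of degree 2 and weight $k$ on $\Gamma=\mathrm{Sp}_4(\mathbb{Z})$, with Fourier coefficients $a(N)$ indexed by symmetric positive semi-definite half-integral $2\times2$ matrices $N$; $I$ is the $2\times2$ identity matrix. Let $S^{(2)}$ be the set of integral $4\times 4$ matrices $M$ with ${}^tMJM=r(M)J$, $r(M)\in\mathbb{Z}^+$, $J=\left(\begin{smallmatrix}0&I\\-I&0\end{smallmatrix}\right)$. For a double coset $\Gamma M\Gamma=\bigcup_i\Gamma\sigma_i$, $T_k(\Gamma M\Gamma)F=r(M)^{2k-3}\sum_i F|_k\sigma_i$, where $F|_k\sigma(Z)=\textup{Det}(CZ+D)^{-k}F((AZ+B)(CZ+D)^{-1})$ for $\sigma=\left(\begin{smallmatrix}A&B\\C&D\end{smallmatrix}\right)$. The Hecke operator of index $m$ is $T_k(m)=\sum_{r(M)=m}T_k(\Gamma M\Gamma)$, and for an eigenform $F$, $\lambda_F(m)$ is defined by $T_k(m)F=\lambda_F(m)F$. *)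

(* Defs.v *)
From mathcomp Require Import all_boot all_order all_algebra.
From mathcomp Require Import all_classical all_reals all_analysis.
From mathcomp Require Import complex summability.
Import Order.TTheory GRing.Theory Num.Theory numFieldNormedType.Exports.

Set Implicit Arguments.
Unset Strict Implicit.
Unset Printing Implicit Defensive.

Local Open Scope classical_set_scope.
Local Open Scope complex_scope.
Local Open Scope ring_scope.

Section Symplectic.

Definition J : 'M[int]_(2 + 2) := block_mx 0 1%:M (- 1%:M) 0.

(* Sp_4(Z) *)
Definition Gamma : set 'M[int]_(2 + 2) := [set g | g^T *m J *m g = J].

(* If tM J M = r J, then r is the entry of tM J M in row 1, column 3, where
   J has entry 1. *)
Definition multiplier (M : 'M[int]_(2 + 2)) : int :=
  (M^T *m J *m M) (lshift 2 0) (rshift 2 0).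

Definition S2 : set 'M[int]_(2 + 2) :=
  [set M | 0 < multiplier M /\ M^T *m J *m M = multiplier M *: J].

Definition left_coset (s : 'M[int]_(2 + 2)) : set 'M[int]_(2 + 2) :=
  [set g *m s | g in Gamma].

Definition double_coset (M : 'M[int]_(2 + 2)) : set 'M[int]_(2 + 2) :=
  [set g *m M *m h | g in Gamma & h in Gamma].

Definition left_cosets_in (M : 'M[int]_(2 + 2)) :
    set (set 'M[int]_(2 + 2)) :=
  [set left_coset s | s in double_coset M].

Definition double_cosets_of (m : nat) : set (set 'M[int]_(2 + 2)) :=
  [set double_coset M | M in S2 `&` [set M | multiplier M = m%:Z]].

(* An arbitrary element of a coset. *)
Definition representative (c : set 'M[int]_(2 + 2)) : 'M[int]_(2 + 2) :=
  xget 1%:M c.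

End Symplectic.

Section SiegelForms.
Variable R : realType.

Definition posdef n (Y : 'M[R]_n) : Prop :=
  Y^T = Y /\ forall v : 'cV[R]_n, v != 0 -> 0 < (v^T *m Y *m v) 0 0.

Definition possemidef n (Y : 'M[R]_n) : Prop :=
  Y^T = Y /\ forall v : 'cV[R]_n, 0 <= (v^T *m Y *m v) 0 0.

(* Siegel upper half-space of degree 2. Functions on it are represented by
   functions on all of 'M_2; their values elsewhere are never used. *)
Definition H2 : set 'M[R[i]]_2 :=
  [set Z | Z^T = Z /\ posdef (map_mx (@complex.Im R) Z)].

(* The coordinates (tau, z, tau') on symmetric matrices; H2 is an open
   subset of this 3-dimensional space, but not of 'M_2. *)
Definition sym2 (x : 'rV[R[i]]_3) : 'M[R[i]]_2 :=
  \matrix_(i, j) x 0 (inord (i + j)).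

Definition holomorphic_H2 (F : 'M[R[i]]_2 -> R[i]) : Prop :=
  forall x : ('rV[R[i]]_3 : normedModType R[i]), H2 (sym2 x) ->
    differentiable ((F \o sym2) : 'rV[R[i]]_3 -> R[i]^o) x.

(* F |_k s *)
Definition slash (k : int) (s : 'M[int]_(2 + 2)) (F : 'M[R[i]]_2 -> R[i])
    (Z : 'M[R[i]]_2) : R[i] :=
  let toC (X : 'M[int]_2) : 'M[R[i]]_2 := map_mx intr X in
  let A := toC (ulsubmx s) in let B := toC (ursubmx s) in
  let C := toC (dlsubmx s) in let D := toC (drsubmx s) in
  \det (C *m Z + D) ^ (- k) * F ((A *m Z + B) *m invmx (C *m Z + D)).

(* No growth condition is imposed: in degree 2 boundedness at the cusp is
   automatic (Koecher principle). *)
Definition siegel_modular_form (k : int) (F : 'M[R[i]]_2 -> R[i]) : Prop :=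
  holomorphic_H2 F /\
  forall g Z, Gamma g -> H2 Z -> slash k g F Z = F Z.

Definition cexp (z : R[i]) : R[i] :=
  (expR (complex.Re z) * cos (complex.Im z)) +i*
  (expR (complex.Re z) * sin (complex.Im z)).

Definition half_integral (N : 'M[R]_2) : Prop :=
  (forall i, N i i \is a Num.int) /\ (forall i j, 2 * N i j \is a Num.int).

Definition fourier_index : set 'M[R]_2 :=
  [set N | half_integral N /\ possemidef N].

Definition fourier_term (a : 'M[R]_2 -> R[i]) (Z : 'M[R[i]]_2)
    (N : 'M[R]_2) : R[i] :=
  if N \in fourier_index
  then a N * cexp ((0 +i* (2 * pi)) * \tr (map_mx (real_complex R) N *m Z))
  else 0.

(* The series is summed unconditionally, i.e. along the net of finite sets of
   indices. *)
Definition fourier_expansion (a : 'M[R]_2 -> R[i])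
    (F : 'M[R[i]]_2 -> R[i]) : Prop :=
  forall Z, H2 Z ->
    partial_sum (fourier_term a Z : 'M[R]_2 -> R[i]^o) A @[A --> totally]
      --> (F Z : R[i]^o).

(* T_k(Gamma M Gamma) F. The sums here and below are over finite sets, and for
   F modular they do not depend on the representatives. *)
Definition hecke_double_coset (k : int) (M : 'M[int]_(2 + 2))
    (F : 'M[R[i]]_2 -> R[i]) (Z : 'M[R[i]]_2) : R[i] :=
  (multiplier M)%:~R ^ (2 * k - 3) *
  \sum_(c \in left_cosets_in M) slash k (representative c) F Z.

(* T_k(m) F *)
Definition hecke (k : int) (m : nat) (F : 'M[R[i]]_2 -> R[i])
    (Z : 'M[R[i]]_2) : R[i] :=
  \sum_(D \in double_cosets_of m)
    hecke_double_coset k (representative D) F Z.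

Definition is_hecke_eigenvalue (k : int) (F : 'M[R[i]]_2 -> R[i]) (m : nat)
    (l : R[i]) : Prop :=
  forall Z, H2 Z -> hecke k m F Z = l * F Z.

Definition eigenform (k : int) (F : 'M[R[i]]_2 -> R[i]) : Prop :=
  [/\ siegel_modular_form k F,
      exists2 Z, H2 Z & F Z != 0 &
      forall m, (0 < m)%N -> exists l, is_hecke_eigenvalue k F m l].

(* lambda_F(m) *)
Definition hecke_eigenvalue (k : int) (F : 'M[R[i]]_2 -> R[i]) (m : nat) :
    R[i] :=
  xget 0 (is_hecke_eigenvalue k F m).

End SiegelForms.

Definition h1 (p : nat) : nat :=
  if (p %% 4 == 1)%N then 2 else if p == 2 then 1 else 0.

Definition h2 (p : nat) : nat :=
  if (p %% 4 == 1)%N then 2 else 0.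

(* Main.v *)
(* For every m > 0 the eigenvalue has a closed form,
     lambda_F(m) = sum_(d | m) r(m/d) (m/d)^(k-2) a(dI),
   with r(e) the number of square roots of -1 modulo e; the theorem is the case
   m = p, p^2.  The left cosets of similitude m have upper triangular
   representatives (A, B; 0, D) with D = (d1, 0; t, d2) in Hermite normal form.
   In the coefficient of T(m)F at I, such a coset only sees the coefficient of F
   at N = D D^T / m, with weight e(Tr(D^T B) / m); Z is replaced by mZ to keep all
   frequencies half-integral.  Summing this character over B forces d1 = m, then
   t = d2 t' and m/d2 | 1 + t'^2, so that N is d2 times an integral form of
   determinant 1, hence equivalent to d2 I.
   Coefficients are extracted from the unconditionally convergent expansion by
   averaging over finitely many real translates of a point. *)
Require Import Defs.
From mathcomp Require Import finmap summability.
From mathcomp Require Import all_boot all_order all_algebra all_field.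
From mathcomp Require Import all_classical all_reals all_analysis.
From mathcomp Require Import complex.
From mathcomp Require Import zify ring lra.
Import Order.TTheory GRing.Theory Num.Theory numFieldNormedType.Exports.

Set Implicit Arguments.
Unset Strict Implicit.
Unset Printing Implicit Defensive.

Local Open Scope classical_set_scope.
Local Open Scope ring_scope.

(** * Matrices of size two *)

(** All double cosets of similitude [m] together make up all similitudes [m] modulo [Gamma], so a
    general [m] is no harder than a prime, and [p^2] needs no separate treatment of its double
    cosets. The base coefficient [I] makes the formula close up because the frequencies left after
    the character sums are multiples of forms of discriminant -4, whose class number is one; several
    classes would mix several coefficients. Two obstacles shape the rest. Coefficients are recovered
    as limits of finite averages, and the interchange of limit and series has to rest on
    unconditional convergence alone. It works because, for every [L], the terms surviving the
    average form a subfamily of one fixed convergent series, the expansion at the base point, so a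
    single Cauchy tail serves all [L]. Moreover the Hecke sum is written with arbitrary coset
    representatives, and [invmx] is a true inverse only on invertible matrices; independence of the
    representative therefore rests on the invertibility of [C Z + D] on the upper half-space. *)

Definition mx2 (T : Type) (a b c d : T) : 'M[T]_2 :=
  \matrix_(i, j) if i == 0 then (if j == 0 then a else b)
                 else (if j == 0 then c else d).

Lemma ord2P (P : 'I_2 -> Prop) : P 0 -> P 1 -> forall i, P i.
Proof.
move=> P0 P1 [[|[|//]] h].
  by rewrite (_ : Ordinal h = 0) //; exact/val_inj.
by rewrite (_ : Ordinal h = 1) //; exact/val_inj.
Qed.

Lemma mx2_eta (T : Type) (A : 'M[T]_2) :
  A = mx2 (A 0 0) (A 0 1) (A 1 0) (A 1 1).
Proof. by apply/matrixP; elim/ord2P; elim/ord2P; rewrite mxE. Qed.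

Lemma mx2_inj (T : Type) (a b c d a' b' c' d' : T) :
  mx2 a b c d = mx2 a' b' c' d' -> [/\ a = a', b = b', c = c' & d = d'].
Proof.
move=> /matrixP e.
by split; [move: (e 0 0)|move: (e 0 1)|move: (e 1 0)|move: (e 1 1)];
  rewrite !mxE.
Qed.

Lemma tr_mx2 (T : Type) (a b c d : T) : (mx2 a b c d)^T = mx2 a c b d.
Proof. by apply/matrixP; elim/ord2P; elim/ord2P; rewrite !mxE. Qed.

Lemma mul_mx2 (T : pzRingType) (a b c d a' b' c' d' : T) :
  mx2 a b c d *m mx2 a' b' c' d' =
  mx2 (a * a' + b * c') (a * b' + b * d') (c * a' + d * c') (c * b' + d * d').
Proof.
by apply/matrixP; elim/ord2P; elim/ord2P; rewrite !mxE !big_ord_recl big_ord0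
  !mxE /= addr0.
Qed.

Lemma add_mx2 (T : pzRingType) (a b c d a' b' c' d' : T) :
  mx2 a b c d + mx2 a' b' c' d' = mx2 (a + a') (b + b') (c + c') (d + d').
Proof. by apply/matrixP; elim/ord2P; elim/ord2P; rewrite !mxE. Qed.

Lemma opp_mx2 (T : pzRingType) (a b c d : T) :
  - mx2 a b c d = mx2 (- a) (- b) (- c) (- d).
Proof. by apply/matrixP; elim/ord2P; elim/ord2P; rewrite !mxE. Qed.

Lemma scale_mx2 (T : pzRingType) (x a b c d : T) :
  x *: mx2 a b c d = mx2 (x * a) (x * b) (x * c) (x * d).
Proof. by apply/matrixP; elim/ord2P; elim/ord2P; rewrite !mxE. Qed.

Lemma scalar_mx2 (T : pzRingType) (x : T) : x%:M = mx2 x 0 0 x.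
Proof. by apply/matrixP; elim/ord2P; elim/ord2P; rewrite !mxE. Qed.

Lemma map_mx2 (T U : Type) (f : T -> U) (a b c d : T) :
  map_mx f (mx2 a b c d) = mx2 (f a) (f b) (f c) (f d).
Proof. by apply/matrixP; elim/ord2P; elim/ord2P; rewrite !mxE. Qed.

Lemma mxtrace2 (T : pzRingType) (a b c d : T) : \tr (mx2 a b c d) = a + d.
Proof. by rewrite /mxtrace !big_ord_recl big_ord0 !mxE addr0. Qed.

Lemma det_mx2 (T : comPzRingType) (a b c d : T) :
  \det (mx2 a b c d) = a * d - b * c.
Proof.
rewrite (expand_det_row _ 0) !big_ord_recl big_ord0 /cofactor !det_mx11 !mxE.
by rewrite /= addr0 expr0 expr1 mul1r mulN1r mulrN.
Qed.

Definition mx2E := (tr_mx2, mul_mx2, add_mx2, opp_mx2, scale_mx2, scalar_mx2,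
  map_mx2, mxtrace2, det_mx2).

Definition symplectic_similitude (m : int) (M : 'M[int]_(2 + 2)) : Prop :=
  M^T *m J *m M = m *: J.

Lemma form_block (A B C D : 'M[int]_2) :
  (block_mx A B C D)^T *m J *m block_mx A B C D =
  block_mx (A^T *m C - C^T *m A) (A^T *m D - C^T *m B)
           (B^T *m C - D^T *m A) (B^T *m D - D^T *m B).
Proof.
rewrite /J tr_block_mx !mulmx_block.
rewrite !mulmx0 !mulmx1 !mulmxN !mulmx1 !add0r !addr0 !mulNmx.
by congr block_mx; rewrite addrC.
Qed.

Lemma J_mx2 : J = block_mx (mx2 0 0 0 0) (mx2 1 0 0 1)
                           (mx2 (-1) 0 0 (-1)) (mx2 0 0 0 0).
Proof.
rewrite /J scalar_mx2 opp_mx2 oppr0; congr block_mx;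
  by apply/matrixP; elim/ord2P; elim/ord2P; rewrite !mxE.
Qed.

Section Entries.
Variables (m a11 a12 a21 a22 b11 b12 b21 b22 c11 c12 c21 c22 d11 d12 d21 d22
  : int).

(** Entrywise relations let the later matrix identities be settled by integer arithmetic. *)
Lemma similitude_mx2 :
  symplectic_similitude m
    (block_mx (mx2 a11 a12 a21 a22) (mx2 b11 b12 b21 b22)
              (mx2 c11 c12 c21 c22) (mx2 d11 d12 d21 d22)) <->
  [/\ a11 * c12 + a21 * c22 = c11 * a12 + c21 * a22,
      b11 * d12 + b21 * d22 = d11 * b12 + d21 * b22,
      a11 * d11 + a21 * d21 - (c11 * b11 + c21 * b21) = m,
      a12 * d12 + a22 * d22 - (c12 * b12 + c22 * b22) = m &
      a11 * d12 + a21 * d22 = c11 * b12 + c21 * b22 /\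
      a12 * d11 + a22 * d21 = c12 * b11 + c22 * b21].
Proof.
rewrite /symplectic_similitude form_block J_mx2 scale_block_mx !mx2E.
split.
  move=> h; have [h1 h2 _ h3] := eq_block_mx h.
  have [_ ? _ _] := mx2_inj h1; have [? ? ? ?] := mx2_inj h2.
  have [_ ? _ _] := mx2_inj h3.
  by split; [lia|lia|lia|lia|split; lia].
by move=> [? ? ? ? [? ?]]; congr block_mx; congr mx2; lia.
Qed.

End Entries.

(** * Symplectic similitudes and cosets of Sp4(Z) *)

Lemma similitudeM (m n : int) (g h : 'M[int]_(2 + 2)) :
  symplectic_similitude m g -> symplectic_similitude n h ->
  symplectic_similitude (m * n) (g *m h).
Proof.
rewrite /symplectic_similitude => hg hh.
rewrite trmx_mul !mulmxA -(mulmxA h^T) -(mulmxA h^T) hg.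
by rewrite -scalemxAr -scalemxAl hh scalerA.
Qed.

Lemma GammaE (g : 'M[int]_(2 + 2)) : Gamma g <-> symplectic_similitude 1 g.
Proof. by rewrite /Gamma /symplectic_similitude /= scale1r. Qed.

Lemma Gamma1 : Gamma 1%:M.
Proof. by rewrite /Gamma /= trmx1 mul1mx mulmx1. Qed.

Lemma GammaM (g h : 'M[int]_(2 + 2)) : Gamma g -> Gamma h -> Gamma (g *m h).
Proof.
move=> /GammaE hg /GammaE hh; apply/GammaE.
by rewrite -[1]mulr1; exact: similitudeM.
Qed.

Lemma JJ : J *m J = - 1%:M.
Proof.
rewrite /J mulmx_block !mul0mx !mulmx0 !mulmx1 mul1mx add0r !addr0.
by rewrite scalar_mx_block opp_block_mx !oppr0.
Qed.

(** The symplectic inverse is [- J g^T J], because [J^2 = -1]. *)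
Lemma GammaV (g : 'M[int]_(2 + 2)) : Gamma g ->
  exists h, [/\ Gamma h, h *m g = 1%:M & g *m h = 1%:M].
Proof.
move=> hg; have e : (- J *m g^T *m J) *m g = 1%:M.
  by rewrite -!mulmxA (mulmxA g^T) [_ *m _ *m g]hg mulNmx JJ opprK.
exists (- J *m g^T *m J); split=> //; last exact: mulmx1C.
set h := _ *m J in e *; have e' := mulmx1C e.
rewrite /Gamma /= -[in LHS]hg.
rewrite -!mulmxA e' mulmx1 !mulmxA -trmx_mul e' trmx1 mul1mx.
by [].
Qed.

Lemma left_coset_eq (s s' : 'M[int]_(2 + 2)) :
  left_coset s = left_coset s' <-> exists2 g, Gamma g & s' = g *m s.
Proof.
split.
  move=> e; have : left_coset s s'.
    by rewrite e; exists 1%:M; rewrite ?mul1mx//; exact: Gamma1.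
  by move=> [g hg <-]; exists g.
move=> [g hg ->]; apply/seteqP; split=> _ [h hh <-].
  have [g' [hg' e _]] := GammaV hg.
  exists (h *m g'); first exact: GammaM.
  by rewrite mulmxA -(mulmxA h) e mulmx1.
by exists (h *m g); [exact: GammaM|rewrite mulmxA].
Qed.

Lemma double_coset_refl (s : 'M[int]_(2 + 2)) : double_coset s s.
Proof.
by exists 1%:M; [exact: Gamma1|exists 1%:M; [exact: Gamma1|rewrite mul1mx mulmx1]].
Qed.

Lemma double_coset_eq (s s' : 'M[int]_(2 + 2)) :
  double_coset s s' -> double_coset s' = double_coset s.
Proof.
move=> [g hg [h hh <-]]; apply/seteqP; split=> _ [g1 hg1 [h1 hh1 <-]].
  exists (g1 *m g); first exact: GammaM.
  by exists (h *m h1); [exact: GammaM|rewrite !mulmxA].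
have [g' [hg' eg _]] := GammaV hg; have [h' [hh' _ eh]] := GammaV hh.
exists (g1 *m g'); first exact: GammaM.
exists (h' *m h1); first exact: GammaM.
by rewrite !mulmxA -(mulmxA g1) eg mulmx1 -(mulmxA _ h) eh mulmx1.
Qed.

Lemma double_coset_left (g s : 'M[int]_(2 + 2)) : Gamma g ->
  double_coset s (g *m s).
Proof.
by exists g => //; exists 1%:M; [exact: Gamma1|rewrite mulmx1].
Qed.

Lemma similitude_double_coset (m : int) (s s' : 'M[int]_(2 + 2)) :
  symplectic_similitude m s -> double_coset s s' -> symplectic_similitude m s'.
Proof.
move=> hs [g /GammaE hg [h /GammaE hh <-]].
by rewrite -[m]mul1r -[1 * m]mulr1; apply: similitudeM => //; exact: similitudeM.
Qed.

Lemma multiplierE (m : int) (s : 'M[int]_(2 + 2)) :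
  symplectic_similitude m s -> multiplier s = m.
Proof.
rewrite /multiplier => ->; rewrite mxE /J block_mxEur mxE eqxx /=.
by rewrite mulr1.
Qed.

Lemma S2E (m : nat) (s : 'M[int]_(2 + 2)) : (0 < m)%N ->
  (S2 s /\ multiplier s = m%:Z) <-> symplectic_similitude m%:Z s.
Proof.
move=> m0; split=> [[[_ h] <-]//|h].
by rewrite /S2 /= (multiplierE h); split.
Qed.

(** * Normal form of the left cosets of symplectic similitudes *)

Lemma sl2_annihilate (x y : int) :
  exists p q r s : int, p * s - q * r = 1 /\ r * x + s * y = 0.
Proof.
have [/eqP g0|g0] := boolP (gcdz x y == 0).
  move: g0; rewrite -[0]/(0%:Z) => /eqP; rewrite gcdz_eq0 => /andP[/eqP -> /eqP ->].
  by exists 1, 0, 0, 1; lia.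
have [u [v uv]] := Bezoutz x y.
have /dvdzP[x' ex] := dvdz_gcdl x y; have /dvdzP[y' ey] := dvdz_gcdr x y.
(* The Bezout pair above the primitive vector orthogonal to [(x, y)]; dividing the Bezout identity
   by the gcd gives determinant one. *)
exists u, v, (- y'), x'; move: g0 uv ex ey; move: (gcdz x y) => g g0 uv ex ey.
split; last by rewrite ex ey; ring.
apply: (mulIf g0); rewrite mul1r -[RHS]uv ex ey; ring.
Qed.

Definition left_equiv (M M' : 'M[int]_(2 + 2)) : Prop :=
  exists2 g, Gamma g & M' = g *m M.

Lemma left_equiv_trans M1 M2 M3 :
  left_equiv M1 M2 -> left_equiv M2 M3 -> left_equiv M1 M3.
Proof.
move=> [g hg ->] [h hh ->]; exists (h *m g); first exact: GammaM.
by rewrite mulmxA.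
Qed.

Lemma left_equiv_similitude m M M' :
  left_equiv M M' -> symplectic_similitude m M -> symplectic_similitude m M'.
Proof.
by move=> [g /GammaE hg ->] hM; rewrite -[m]mul1r; exact: similitudeM.
Qed.

Lemma mx2_block_eta (M : 'M[int]_(2 + 2)) :
  exists a11 a12 a21 a22 b11 b12 b21 b22 c11 c12 c21 c22 d11 d12 d21 d22,
  M = block_mx (mx2 a11 a12 a21 a22) (mx2 b11 b12 b21 b22)
               (mx2 c11 c12 c21 c22) (mx2 d11 d12 d21 d22).
Proof.
rewrite -[M]submxK (mx2_eta (ulsubmx M)) (mx2_eta (ursubmx M)).
rewrite (mx2_eta (dlsubmx M)) (mx2_eta (drsubmx M)).
by do 16! eexists; reflexivity.
Qed.

(** An embedded SL2 x SL2 clears the first column of [C], and a block-diagonal element [(U, U^-T)]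
    then clears [a21]. At that point the similitude relations read [a11 d11 = m] and [a11 c12 = 0],
    which forces [c12 = 0]; one more SL2, in the second coordinate pair, removes [c22]. *)
Lemma reduce_columns (m : int) (M : 'M[int]_(2 + 2)) : m != 0 ->
  symplectic_similitude m M ->
  exists a11 a12 a22 b11 b12 b21 b22 d11 d12 d21 d22,
  left_equiv M (block_mx (mx2 a11 a12 0 a22) (mx2 b11 b12 b21 b22)
                         (mx2 0 0 0 0) (mx2 d11 d12 d21 d22)).
Proof.
move=> m0 hM.
suff [M1 [M1e [a11 [a12 [a22 [b11 [b12 [b21 [b22 [c12 [c22 [d11 [d12 [d21 [d22 e]]]]]]]]]]]]]]] :
  exists M1, left_equiv M M1 /\
  exists a11 a12 a22 b11 b12 b21 b22 c12 c22 d11 d12 d21 d22,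
  M1 = block_mx (mx2 a11 a12 0 a22) (mx2 b11 b12 b21 b22)
                (mx2 0 c12 0 c22) (mx2 d11 d12 d21 d22).
  have := left_equiv_similitude M1e hM; rewrite {1}e => /similitude_mx2[h1 _ h2 h3 _].
  have a0 : a11 != 0 by apply: contraNneq m0 => a0; rewrite a0 in h2; lia.
  have c0 : c12 = 0 by apply: (mulfI a0); lia.
  have [p [q [r [s [ps rs]]]]] := sl2_annihilate a22 c22.
  do 11! eexists; apply: left_equiv_trans M1e _.
  exists (block_mx (mx2 1 0 0 p) (mx2 0 0 0 q) (mx2 0 0 0 r) (mx2 1 0 0 s)).
    by apply/GammaE/similitude_mx2; split; [lia|lia|lia|lia|split; lia].
  rewrite e mulmx_block !mx2E c0.
  by congr block_mx; congr mx2; try reflexivity; lia.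
have [a11 [a12 [a21 [a22 [b11 [b12 [b21 [b22 [c11 [c12 [c21 [c22 [d11 [d12 [d21 [d22 e]]]]]]]]]]]]]]]]
  := mx2_block_eta M.
have [p [q [r [s [ps rs]]]]] := sl2_annihilate a11 c11.
have [p' [q' [r' [s' [ps' rs']]]]] := sl2_annihilate a21 c21.
have [P [Q [R [S [PS RS]]]]] :=
  sl2_annihilate (p * a11 + q * c11) (p' * a21 + q' * c21).
eexists; split; last first.
  by do 13! eexists; reflexivity.
apply: (@left_equiv_trans _ (block_mx (mx2 p 0 0 p') (mx2 q 0 0 q')
                          (mx2 r 0 0 r') (mx2 s 0 0 s') *m M)).
  eexists; last reflexivity.
  by apply/GammaE/similitude_mx2; split; [lia|lia|lia|lia|split; lia].
exists (block_mx (mx2 P Q R S) (mx2 0 0 0 0) (mx2 0 0 0 0) (mx2 S (- R) (- Q) P)).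
  by apply/GammaE/similitude_mx2; split; [lia|lia|lia|lia|split; lia].
rewrite e !mulmx_block !mx2E.
have k0 x : x * (r * a11 + s * c11) = 0 by rewrite rs mulr0.
have k1 x : x * (r' * a21 + s' * c21) = 0 by rewrite rs' mulr0.
have := (k0 S, k0 (- Q), k1 (- R), k1 P) => {k0 k1} -[[[k0 k1] k2] k3].
congr block_mx; congr mx2; try reflexivity; lia.
Qed.

(* A = m D^-T, and the entry of B below b1 is forced by the symmetry of D^T B;
   all divisions are exact under coset_index. *)
Definition coset_rep (m d1 d2 t b1 b2 b4 : nat) : 'M[int]_(2 + 2) :=
  block_mx
    (mx2 (m %/ d1)%:Z (- (m %/ d2 * t %/ d1)%:Z) 0 (m %/ d2)%:Z)
    (mx2 b1%:Z b2%:Z ((d1 * b2 + t * b4) %/ d2)%:Z b4%:Z)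
    (mx2 0 0 0 0)
    (mx2 d1%:Z 0 t%:Z d2%:Z).

(** The divisibilities make [A] and [B] integral. The unipotent part of [Gamma] changes [B] by [S D]
    with [S] symmetric, hence by three free integers, which reduce [b2] and [b4] modulo [d2] and
    [b1] modulo [d1]. The strict bounds also make [d1] and [d2] positive. *)
Definition coset_index (m d1 d2 t b1 b2 b4 : nat) : bool :=
  [&& d1 %| m, d2 %| m, d1 %| m %/ d2 * t, d2 %| d1 * b2 + t * b4,
      t < d1, b1 < d1, b2 < d2 & b4 < d2]%N.

Lemma coset_indexP (m d1 d2 t b1 b2 b4 : nat) :
  coset_index m d1 d2 t b1 b2 b4 ->
  exists a1 a2 u b3 : nat,
   [/\ (a1 * d1 = m)%N, (a2 * d2 = m)%N, (u * d1 = a2 * t)%N,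
     (b3 * d2 = d1 * b2 + t * b4)%N &
     coset_rep m d1 d2 t b1 b2 b4 =
     block_mx (mx2 a1%:Z (- u%:Z) 0 a2%:Z) (mx2 b1%:Z b2%:Z b3%:Z b4%:Z)
       (mx2 0 0 0 0) (mx2 d1%:Z 0 t%:Z d2%:Z)].
Proof.
case/and5P => h1 h2 h3 h4 _.
exists (m %/ d1)%N, (m %/ d2)%N, (m %/ d2 * t %/ d1)%N,
  ((d1 * b2 + t * b4) %/ d2)%N.
by rewrite !divnK.
Qed.

Lemma coset_rep_similitude (m d1 d2 t b1 b2 b4 : nat) :
  coset_index m d1 d2 t b1 b2 b4 ->
  symplectic_similitude m%:Z (coset_rep m d1 d2 t b1 b2 b4).
Proof.
move=> /coset_indexP[a1 [a2 [u [b3 [h1 h2 h3 h4 ->]]]]].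
apply/similitude_mx2; split; [lia|lia|lia|lia|split; lia].
Qed.

Lemma residue_unique (d x y n : int) :
  0 <= x < d -> 0 <= y < d -> y = x + n * d -> n = 0.
Proof. nia. Qed.

Lemma pos_unit_int (p s : int) : 0 < s -> p * s = 1 -> s = 1.
Proof.
move=> s0 ps; have p0 : 0 < p by rewrite -(pmulr_lgt0 _ s0) ps.
nia.
Qed.

(** Let [g] carry one representative to the other. Its lower-left block kills the invertible [A], so
    it vanishes; its diagonal entries are positive units, hence 1; the residue bounds then kill the
    shear and the translation in turn, leaving [g = 1]. *)
Lemma coset_rep_inj (m d1 d2 t b1 b2 b4 d1' d2' t' b1' b2' b4' : nat) :
  (0 < m)%N ->
  coset_index m d1 d2 t b1 b2 b4 -> coset_index m d1' d2' t' b1' b2' b4' ->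
  left_coset (coset_rep m d1 d2 t b1 b2 b4) =
    left_coset (coset_rep m d1' d2' t' b1' b2' b4') ->
  [/\ d1 = d1', d2 = d2', t = t' & [/\ b1 = b1', b2 = b2' & b4 = b4']].
Proof.
move=> m0 hv hv' /left_coset_eq[g /GammaE hg].
have [a1 [a2 [u [b3 [h1 h2 h3 h4 ->]]]]] := coset_indexP hv.
have [a1' [a2' [u' [b3' [h1' h2' h3' h4' ->]]]]] := coset_indexP hv'.
have [p11 [p12 [p21 [p22 [q11 [q12 [q21 [q22 [r11 [r12 [r21 [r22
  [s11 [s12 [s21 [s22 e]]]]]]]]]]]]]]]] := mx2_block_eta g.
move: hg; rewrite e => /similitude_mx2[k1 k2 k3 k4 [k5 k6]].
rewrite mulmx_block !mx2E => E; have [_ EB EC ED] := eq_block_mx E.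
have {E} [C1 C2 C3 C4] := mx2_inj EC; have [D1 D2 D3 D4] := mx2_inj ED.
have [B1 B2 B3 B4] := mx2_inj EB; clear EB EC ED e.
have /and5P[_ _ _ _ /and4P[v1 v2 v3 v4]] := hv.
have /and5P[_ _ _ _ /and4P[v1' v2' v3' v4']] := hv'.
clear hv hv'.
have a10 : a1%:Z != 0 by lia.
have a20 : a2%:Z != 0 by nia.
have d10 : d1%:Z != 0 by lia.
have d20 : d2%:Z != 0 by lia.
have r110 : r11 = 0 by apply: (mulIf a10); lia.
have r210 : r21 = 0 by apply: (mulIf a10); lia.
have r120 : r12 = 0 by apply: (mulIf a20); rewrite r110 in C2; lia.
have r220 : r22 = 0 by apply: (mulIf a20); rewrite r210 in C4; lia.
rewrite {}r110 {}r210 {}r120 {}r220 in k1 k3 k4 k5 k6 C1 C2 C3 C4 D1 D2 D3 D4.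
have s120 : s12 = 0 by apply: (mulIf d20); lia.
rewrite {}s120 in k2 k3 k4 k5 k6 D1 D2 D3 D4.
have d1p : 0 < d1%:Z by lia.
have d2p : 0 < d2%:Z by lia.
have s110 : 0 < s11 by rewrite -(pmulr_lgt0 _ d1p); lia.
have s220 : 0 < s22 by rewrite -(pmulr_lgt0 _ d2p); lia.
have p210 : p21 = 0 by apply: (mulIf (lt0r_neq0 s220)); lia.
rewrite {}p210 in k3 k4 k5 k6 B3 B4.
have s11E : s11 = 1 by apply: (@pos_unit_int p11); lia.
have s22E : s22 = 1 by apply: (@pos_unit_int p22); lia.
rewrite {}s11E {}s22E in k2 k3 k4 k5 k6 D1 D2 D3 D4.
have s21E : s21 = 0.
  by apply: (@residue_unique d1' t t'); lia.
rewrite {}s21E in k2 k3 k4 k5 k6 D1 D2 D3 D4.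
have p12E : p12 = 0 by lia.
have p11E : p11 = 1 by lia.
have p22E : p22 = 1 by lia.
rewrite {}p11E {}p12E {}p22E in B1 B2 B3 B4.
(* [q11] comes last: [b1] is shifted by [q11 d1 + q12 t], a multiple of [d1] only once [q12 = 0].
   The value of [q21] follows from symmetry. *)
have q12E : q12 = 0 by apply: (@residue_unique d2' b2 b2'); lia.
have q21E : q21 = 0 by lia.
have q22E : q22 = 0 by apply: (@residue_unique d2' b4 b4'); lia.
rewrite {}q12E {}q21E {}q22E in B1 B2 B3 B4.
have q11E : q11 = 0 by apply: (@residue_unique d1' b1 b1'); lia.
rewrite {}q11E in B1 B2 B3 B4.
by split; [lia|lia|lia|split; lia].
Qed.

Lemma residue_exists (d x : int) : 0 < d -> exists n, 0 <= x + n * d < d.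
Proof.
move=> d0; exists (- (x %/ d)%Z).
have := divz_eq x d; have := modz_ge0 x (lt0r_neq0 d0); have := ltz_pmod x d0.
move: (x %/ d)%Z (x %% d)%Z => q r; lia.
Qed.

Lemma sign_exists (x : int) : x != 0 -> exists2 e, e * e = 1 & 0 < e * x.
Proof. by move=> x0; have [?|?] := ltP 0 x; [exists 1|exists (-1)]; lia. Qed.

Lemma coset_rep_exists (m : nat) (M : 'M[int]_(2 + 2)) : (0 < m)%N ->
  symplectic_similitude m%:Z M ->
  exists d1 d2 t b1 b2 b4, coset_index m d1 d2 t b1 b2 b4 /\
    left_equiv M (coset_rep m d1 d2 t b1 b2 b4).
Proof.
move=> m0 hM; have mz : m%:Z != 0 by lia.
have [a11 [a12 [a22 [b11 [b12 [b21 [b22 [d11 [d12 [d21 [d22 E]]]]]]]]]]] :=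
  reduce_columns mz hM.
have /similitude_mx2 [_ _ k3 _ [k5 _]] := left_equiv_similitude E hM.
have a0 : a11 != 0 by apply: contraNneq mz => a0; rewrite a0 in k3; lia.
have d120 : d12 = 0 by apply: (mulfI a0); lia.
rewrite {}d120 {k5} in E k3.
have /similitude_mx2 [_ _ _ k4 _] := left_equiv_similitude E hM.
have d110 : d11 != 0 by apply: contraNneq mz => d0; rewrite d0 in k3; lia.
have d220 : d22 != 0 by apply: contraNneq mz => d0; rewrite d0 in k4; lia.
have [e1 e1e d11p] := sign_exists d110; have [e2 e2e d22p] := sign_exists d220.
have [n hn] := residue_exists (e2 * d21) d11p.
have [A11 [A12 [A22 [B11 [B12 [B21 [B22 [D11 [D21 [D22 [[D11p D22p D21p] F]]]]]]]]]]] :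
  exists A11 A12 A22 B11 B12 B21 B22 D11 D21 D22,
  [/\ 0 < D11, 0 < D22 & 0 <= D21 < D11] /\
  left_equiv M (block_mx (mx2 A11 A12 0 A22) (mx2 B11 B12 B21 B22)
                         (mx2 0 0 0 0) (mx2 D11 0 D21 D22)).
  do 7! eexists; exists (e1 * d11), (e2 * d21 + n * (e1 * d11)), (e2 * d22).
  split; first by split.
  apply: left_equiv_trans E _.
  exists (block_mx (mx2 1 (-n) 0 1) (mx2 0 0 0 0) (mx2 0 0 0 0) (mx2 1 0 n 1) *m
          block_mx (mx2 e1 0 0 e2) (mx2 0 0 0 0) (mx2 0 0 0 0) (mx2 e1 0 0 e2)).
    by apply: GammaM; apply/GammaE/similitude_mx2;
      (split; [lia|lia|lia|lia|split; lia]).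
  rewrite -mulmxA !mulmx_block !mx2E.
  by congr block_mx; congr mx2; try reflexivity; lia.
(* Adding [S D] with [S = (n1, n2; n2, n4)] moves [B11] by [n1 D11 + n2 D21], so [n2] is chosen
   before [n1]. *)
have [n4 hn4] := residue_exists B22 D22p.
have [n2 hn2] := residue_exists B12 D22p.
have [n1 hn1] := residue_exists (B11 + n2 * D21) D11p.
have {}F : exists B21', left_equiv M (block_mx (mx2 A11 A12 0 A22)
    (mx2 (B11 + n2 * D21 + n1 * D11) (B12 + n2 * D22) B21' (B22 + n4 * D22))
    (mx2 0 0 0 0) (mx2 D11 0 D21 D22)).
  eexists; apply: left_equiv_trans F _.
  exists (block_mx (mx2 1 0 0 1) (mx2 n1 n2 n2 n4) (mx2 0 0 0 0) (mx2 1 0 0 1)).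
    by apply/GammaE/similitude_mx2; split; [lia|lia|lia|lia|split; lia].
  rewrite !mulmx_block !mx2E.
  by congr block_mx; congr mx2; try reflexivity; lia.
move: hn1 hn2 hn4 F.
move: (_ + n1 * _) (_ + n2 * D22) (_ + n4 * _) => b1 b2 b4 hb1 hb2 hb4 [b3 F].
have /similitude_mx2 [_ l1 l2 l3 [_ l4]] := left_equiv_similitude F hM.
have [a1 e1'] : exists a1 : nat, A11 = a1%:Z by exists `|A11|%N; nia.
have [a2 e2'] : exists a1 : nat, A22 = a1%:Z by exists `|A22|%N; nia.
have [u eu] : exists a1 : nat, A12 = - a1%:Z by exists `|A12|%N; nia.
have [d1 ed1] : exists a1 : nat, D11 = a1%:Z by exists `|D11|%N; lia.
have [d2 ed2] : exists a1 : nat, D22 = a1%:Z by exists `|D22|%N; lia.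
have [t et] : exists a1 : nat, D21 = a1%:Z by exists `|D21|%N; lia.
have [x1 ex1] : exists a1 : nat, b1 = a1%:Z by exists `|b1|%N; lia.
have [x2 ex2] : exists a1 : nat, b2 = a1%:Z by exists `|b2|%N; lia.
have [x4 ex4] : exists a1 : nat, b4 = a1%:Z by exists `|b4|%N; lia.
have [x3 ex3] : exists a1 : nat, b3 = a1%:Z by exists `|b3|%N; nia.
subst.
have g1 : (a1 * d1 = m)%N by lia.
have g2 : (a2 * d2 = m)%N by lia.
have g3 : (a2 * t = u * d1)%N by lia.
have g4 : (d1 * x2 + t * x4 = x3 * d2)%N by lia.
have d1p : (0 < d1)%N by lia.
have d2p : (0 < d2)%N by lia.
have q1 : (m %/ d1 = a1)%N by rewrite -g1 mulnK.
have q2 : (m %/ d2 = a2)%N by rewrite -g2 mulnK.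
exists d1, d2, t, x1, x2, x4; split.
  rewrite /coset_index q2 g3 g4 -{1}g1 -g2 !dvdn_mull //=.
  by apply/and4P; split; lia.
by rewrite /coset_rep q1 q2 g3 g4 !mulnK.
Qed.

Lemma representativeP (c : set 'M[int]_(2 + 2)) s : c s -> c (representative c).
Proof. by move=> cs; rewrite /representative; case: xgetP => // /(_ s). Qed.

(** * The Hecke operator as one finite sum over left cosets *)

Section HeckeSum.
Variables (R : realType) (k : int) (F : 'M[R[i]]_2 -> R[i]) (m : nat).
Variables (I : finType) (P : pred I) (s : I -> 'M[int]_(2 + 2)).
Hypothesis m_gt0 : (0 < m)%N.
Hypothesis s_similitude : forall i, P i -> symplectic_similitude m%:Z (s i).
Hypothesis s_inj : forall i j, P i -> P j ->
  left_coset (s i) = left_coset (s j) -> i = j.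
Hypothesis s_surj : forall M, symplectic_similitude m%:Z M ->
  exists2 i, P i & left_equiv M (s i).

Lemma hecke_double_coset_sum (D : set 'M[int]_(2 + 2)) Z :
  double_cosets_of m D ->
  hecke_double_coset k (representative D) F Z =
  m%:R ^ (2 * k - 3) *
  \sum_(i | P i && (double_coset (s i) == D))
    slash k (representative (left_coset (s i))) F Z.
Proof.
move=> [M /(S2E _ m_gt0) hM eD].
have DM : double_coset M (representative D).
  by rewrite -eD; apply: representativeP; exact: double_coset_refl.
have hr := similitude_double_coset hM DM.
have eD' := double_coset_eq DM.
rewrite /hecke_double_coset (multiplierE hr); congr (_ * _).
rewrite -[RHS]big_filter.
rewrite -(big_map (fun i => left_coset (s i)) xpredT
  (fun c => slash k (representative c) F Z)).
rewrite [RHS]fsbig_seq; last first.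
  rewrite map_inj_in_uniq ?filter_uniq ?index_enum_uniq // => i j.
  by rewrite !mem_filter => /andP[/andP[Pi _] _] /andP[/andP[Pj _] _]; exact: s_inj.
apply: eq_fsbigl; apply/seteqP; split=> c /=.
  move=> [x]; rewrite eD' => hx <-.
  have [i Pi [g hg ei]] := s_surj (similitude_double_coset hM hx).
  apply/mapP; exists i.
    rewrite mem_filter Pi mem_index_enum andbT /=; apply/eqP.
    by rewrite -eD -(double_coset_eq hx) ei; apply: double_coset_eq;
      exact: double_coset_left.
  by apply/left_coset_eq; exists g.
move=> hc; case: (mapP hc) => i; rewrite mem_filter => /andP[/andP[Pi /eqP ei] _] ->.
exists (s i) => //.
by rewrite eD' eD -ei; exact: double_coset_refl.
Qed.

(** Each [s i] lies in exactly one double coset, so exchanging the two sums leaves one term per [i].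
    The finite type [I] supplies the finiteness without which the set-indexed sums would take their
    default value. *)
Lemma hecke_sum Z : hecke k m F Z =
  m%:R ^ (2 * k - 3) *
  \sum_(i | P i) slash k (representative (left_coset (s i))) F Z.
Proof.
pose Ds := undup [seq double_coset (s i) | i <- enum P].
have DsE : double_cosets_of m = [set` Ds].
  apply/seteqP; split=> D /=.
    move=> [M /(S2E _ m_gt0) hM <-].
    have [i Pi [g hg ei]] := s_surj hM.
    rewrite mem_undup; apply/mapP; exists i; first by rewrite mem_enum.
    by rewrite ei; apply/esym; apply: double_coset_eq; exact: double_coset_left.
  rewrite mem_undup => hD; case: (mapP hD) => i.
  rewrite mem_enum => Pi ->.
  by exists (s i) => //; apply/(S2E _ m_gt0); exact: s_similitude.
rewrite /hecke.
under eq_fsbigr => D /set_mem hD do rewrite (hecke_double_coset_sum Z hD).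
rewrite DsE -fsbig_seq ?undup_uniq // -big_distrr /=; congr (_ * _).
under eq_bigr do rewrite big_mkcond /=.
rewrite exchange_big /= [RHS]big_mkcond /=; apply: eq_bigr => i _.
case: ifPn => Pi; last by rewrite big1 // => D _; rewrite (negPf Pi).
rewrite -big_mkcond /=.
under eq_bigl do rewrite eq_sym.
rewrite -big_filter (@filter_pred1_uniq _ Ds (double_coset (s i))) ?undup_uniq //.
  by rewrite big_seq1.
by rewrite mem_undup; apply: (map_f (fun i => double_coset (s i))); rewrite mem_enum.
Qed.

End HeckeSum.

(** * The action on the upper half-space *)

Local Open Scope complex_scope.

Notation toC R X := (map_mx (intr : int -> R[i]) X).

Section Slash.
Variable R : realType.
Implicit Types (Z : 'M[R[i]]_2) (F : 'M[R[i]]_2 -> R[i]).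

Lemma slash_block (k : int) (A B C D : 'M[int]_2) F Z :
  slash k (block_mx A B C D) F Z =
  \det (toC R C *m Z + toC R D) ^ (- k) *
  F ((toC R A *m Z + toC R B) *m invmx (toC R C *m Z + toC R D)).
Proof. by rewrite /slash block_mxKul block_mxKur block_mxKdl block_mxKdr. Qed.

Lemma Gamma_block (A B C D : 'M[int]_2) : Gamma (block_mx A B C D) ->
  [/\ A^T *m C = C^T *m A, B^T *m D = D^T *m B & A^T *m D - C^T *m B = 1%:M].
Proof.
rewrite /Gamma /= form_block /J => h; have [h1 h2 _ h4] := eq_block_mx h.
by split=> //; apply/eqP; rewrite -subr_eq0; apply/eqP.
Qed.

(** With [v = x + i y] and [Y = Im Z], the form is [-2i (x^T Y x + y^T Y y)], so its imaginary part
    alone is already nonzero. *)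
Lemma hermitian_form_neq0 Z (v : 'cV[R[i]]_2) : H2 Z -> v != 0 ->
  ((map_mx conjc v)^T *m (map_mx conjc Z - Z) *m v) 0 0 != 0.
Proof.
move=> [Zs [Ys Yp]] v0.
pose x : 'cV[R]_2 := map_mx (@complex.Re R) v.
pose y : 'cV[R]_2 := map_mx (@complex.Im R) v.
have form_ge0 (w : 'cV[R]_2) :
    0 <= (w^T *m map_mx (@complex.Im R) Z *m w) 0 0.
  have [->|w0] := eqVneq w 0; first by rewrite mulmx0 mxE.
  exact/ltW/Yp.
have xy0 : 0 < (x^T *m map_mx (@complex.Im R) Z *m x) 0 0 +
               (y^T *m map_mx (@complex.Im R) Z *m y) 0 0.
  have [x0|x0] := eqVneq x 0; last by apply: ltr_wpDr => //; exact: Yp.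
  apply: ltr_wpDl => //; apply: Yp; apply: contraNneq v0 => y0.
  apply/eqP/matrixP => i j; move/matrixP: x0 => /(_ i j).
  move/matrixP: y0 => /(_ i j); rewrite !mxE.
  by case: (v i j) => a b /= -> ->.
have key : complex.Im (((map_mx conjc v)^T *m (map_mx conjc Z - Z) *m v) 0 0)
  = - 2 * ((x^T *m map_mx (@complex.Im R) Z *m x) 0 0 +
           (y^T *m map_mx (@complex.Im R) Z *m y) 0 0).
  have Z10 : Z 1 0 = Z 0 1 by rewrite -[in LHS]Zs mxE.
  rewrite !mxE !big_ord_recl !big_ord0 !mxE !big_ord_recl !big_ord0 !mxE.
  rewrite (_ : lift ord0 ord0 = 1); last exact/val_inj.
  rewrite (_ : ord0 = 0) // Z10.
  case: (Z 0 0) (Z 0 1) (Z 1 1) (v 0 0) (v 1 0)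
    => [a a'] [b b'] [c c'] [p p'] [q q'] /=.
  ring.
apply: contraTneq xy0 => e; move: key; rewrite e /= => /eqP.
by rewrite eq_sym mulf_eq0 oppr_eq0 pnatr_eq0 /= => /eqP ->; rewrite ltxx.
Qed.

(* If (C Z + D) v = 0 then v^* (conj Z - Z) v = 0, because the form J on the
   columns (Z; 1) is invariant under the symplectic group. *)
Lemma automorphy_unit (A B C D : 'M[int]_2) Z :
  Gamma (block_mx A B C D) -> H2 Z -> toC R C *m Z + toC R D \in unitmx.
Proof.
move=> /Gamma_block[h1 h2 h3] HZ; have [Zs _] := HZ.
have {}h1 := congr1 (map_mx (intr : int -> R[i])) h1.
have {}h2 := congr1 (map_mx (intr : int -> R[i])) h2.
have {}h3 := congr1 (map_mx (intr : int -> R[i])) h3.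
move: h1 h2 h3; rewrite !(map_mxB, map_mxM, map_trmx, map_mx1).
rewrite -!map_trmx.
have cA (X : 'M[int]_2) : map_mx conjc (toC R X) = toC R X.
  by apply/matrixP=> i j; rewrite !mxE rmorph_int.
move: (cA A) (cA B) (cA C) (cA D).
move: (toC R A) (toC R B) (toC R C) (toC R D) => P Q S T cP cQ cS cT h1 h2 h3.
rewrite unitmxE unitfE -det_tr; apply/negP => /det0P[u u0 uV].
set v := u^T.
have v0 : v != 0 by rewrite -(inj_eq trmx_inj) trmxK trmx0.
have Vv : (S *m Z + T) *m v = 0.
  by apply: trmx_inj; rewrite trmx_mul trmxK trmx0.
have := hermitian_form_neq0 HZ v0; apply/negP; rewrite negbK.
set vb := map_mx conjc v; set Zb := map_mx conjc Z.
have Zbs : Zb^T = Zb by rewrite /Zb map_trmx Zs.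
have Vvb : vb^T *m (Zb *m S^T + T^T) = 0.
  have : map_mx conjc ((S *m Z + T) *m v) = 0 by rewrite Vv map_mx0.
  rewrite map_mxM map_mxD map_mxM cS cT => e.
  by rewrite -{1}Zbs -trmx_mul -raddfD -trmx_mul e trmx0.
have -> : Zb - Z = (Zb *m P^T + Q^T) *m (S *m Z + T)
                 - (Zb *m S^T + T^T) *m (P *m Z + Q).
  rewrite !(mulmxDl, mulmxDr) !mulmxA.
  rewrite -(mulmxA Zb _ S) -(mulmxA Zb _ T) -(mulmxA Zb _ P) -(mulmxA Zb _ Q).
  rewrite h1 h2.
  have -> : P^T *m T = 1%:M + S^T *m Q by rewrite -h3 subrK.
  have -> : T^T *m P = 1%:M + Q^T *m S.
    apply: trmx_inj; rewrite raddfD /= !trmx_mul !trmxK trmx1 -h3.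
    by rewrite subrK.
  rewrite mulmxDr mulmxDl mulmx1 mul1mx.
  set X1 := Zb *m _ *m Z; set X2 := Zb *m _; set X3 := _ *m Z; set X4 := _ *m Q.
  move: X1 X2 X3 X4 => X1 X2 X3 X4.
  by apply/matrixP => i j; rewrite !mxE; ring.
by rewrite mulmxBr mulmxBl -mulmxA -(mulmxA _ (_ + T)) Vv !mulmx0 !mulmxA Vvb
  !mul0mx subrr mxE.
Qed.

(** The cocycle relation at the point [(A Z + B) D^-1]. It allows an arbitrary element of a left
    coset to be replaced by the upper triangular one. *)
Lemma slash_Gamma (k : int) F (g : 'M[int]_(2 + 2)) (A B D : 'M[int]_2) Z :
  siegel_modular_form k F -> Gamma g -> \det (toC R D) != 0 ->
  H2 ((toC R A *m Z + toC R B) *m invmx (toC R D)) ->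
  slash k (g *m block_mx A B 0 D) F Z = slash k (block_mx A B 0 D) F Z.
Proof.
move=> [_ Fmod]; rewrite -[g]submxK.
move: (ulsubmx g) (ursubmx g) (dlsubmx g) (drsubmx g) => P Q S T hg D0 HZ'.
rewrite mulmx_block !slash_block !mulmx0 !addr0 map_mx0 mul0mx add0r.
have Du : toC R D \in unitmx by rewrite unitmxE unitfE.
set Z' := _ *m invmx _ in HZ' *.
have eN (X Y : 'M[int]_2) : toC R (X *m A) *m Z + toC R (X *m B + Y *m D) =
    (toC R X *m Z' + toC R Y) *m toC R D.
  rewrite !(map_mxM, map_mxD) /Z' mulmxDl -!mulmxA mulVmx // mulmx1.
  by rewrite mulmxDr addrA.
have := Fmod _ _ hg HZ'; rewrite slash_block => <-.
rewrite !eN det_mulmx expfzMl [X in X * F _ = _]mulrC -mulrA; congr (_ * _).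
congr (_ * F _); rewrite -!mulmxA; congr (_ *m _).
have Wu := automorphy_unit hg HZ'.
by rewrite -[LHS](mulKmx Wu) (mulmxA (_ + _)) mulmxV ?mulmx1 // unitmx_mul Wu.
Qed.

End Slash.

(** * Fourier coefficients *)

Section Exponential.
Variable R : realType.
Implicit Types (z w : R[i]) (x : R).

Definition expc2pi z : R[i] := cexp ((0 +i* (2 * pi)) * z).

Lemma cexpD z w : cexp (z + w) = cexp z * cexp w.
Proof.
case: z w => [a b] [c d]; apply/eqP; rewrite eq_complex /=.
by rewrite expRD cosD sinD; apply/andP; split; apply/eqP; ring.
Qed.

Lemma expc2piD z w : expc2pi (z + w) = expc2pi z * expc2pi w.
Proof. by rewrite /expc2pi mulrDr cexpD. Qed.

Lemma expc2pi0 : expc2pi 0 = 1.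
Proof. by rewrite /expc2pi mulr0 /cexp /= expR0 cos0 sin0 mulr1 mulr0. Qed.

Lemma expc2pi_muln z n : expc2pi (z * n%:R) = expc2pi z ^+ n.
Proof.
elim: n => [|n IH]; first by rewrite mulr0 expc2pi0 expr0.
by rewrite -natr1 mulrDr mulr1 expc2piD IH exprSr.
Qed.

Lemma expc2piE x : expc2pi x%:C = cos (2 * pi * x) +i* sin (2 * pi * x).
Proof.
rewrite /expc2pi /cexp /= !(mul0r, mulr0, subr0, oppr0, addr0, add0r).
by rewrite expR0 !mul1r.
Qed.

Lemma expc2pi1 : expc2pi 1 = 1.
Proof.
rewrite -[1 in LHS]/(1%:C) expc2piE mulr1.
by rewrite mulr_natl cos2pi sin2pi.
Qed.

Lemma expc2pi_int (n : int) : expc2pi n%:~R = 1.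
Proof.
have en (k : nat) : expc2pi k%:R = 1.
  by rewrite -[k%:R]mul1r expc2pi_muln expc2pi1 expr1n.
case: n => n; first exact: en.
have := expc2pi0; rewrite -[X in expc2pi X](subrr (n.+1%:R)) expc2piD en mul1r.
by rewrite NegzE intrN.
Qed.

(** If [cos (2 pi x) = 1], the duplication formula gives [sin (pi x) = 0], whereas the sine is
    positive on [(0, pi)]. *)
Lemma expc2pi_fraction_neq1 x : 0 < x < 1 -> expc2pi x%:C != 1.
Proof.
move=> /andP[x0 x1]; rewrite expc2piE; apply/negP => /eqP[+ _].
rewrite -mulrA mulr_natl cos_mulr2n => h.
have s0 : 0 < sin (pi * x).
  apply: sin_gt0_pi; rewrite mulr_gt0 ?pi_gt0 //=.
  by rewrite -[ltRHS]mulr1 ltr_pM2l ?pi_gt0.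
have := cos2Dsin2 (pi * x); nra.
Qed.

Lemma expc2pi_eq1 (q : nat) (n : int) : (0 < q)%N ->
  (expc2pi (n%:~R / q%:R) == 1) = (q %| n)%Z.
Proof.
move=> q0; have qc : q%:R != 0 :> R[i] by rewrite pnatr_eq0 -lt0n.
rewrite {1}(divz_eq n q) intrD intrM mulrDl expc2piD.
rewrite -[q%:~R]/(q%:R) mulfK // expc2pi_int mul1r.
rewrite (sameP dvdz_mod0P eqP).
have qz : q%:Z != 0 by lia.
have := ltz_pmod n (_ : 0 < q%:Z); move/(_ q0).
have := modz_ge0 n qz; case: (n %% q)%Z => // r _ h1.
have [->|r0] := posnP r; first by rewrite mul0r expc2pi0 !eqxx.
have -> : r%:~R / q%:R = (r%:R / q%:R : R)%:C.
  by rewrite rmorphM /= fmorphV /= !rmorph_nat.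
apply/idP/idP => [|/eqP[er]]; last by rewrite er in r0.
rewrite (negPf (expc2pi_fraction_neq1 _)) //.
rewrite divr_gt0 ?ltr0n //= ltr_pdivrMr ?ltr0n // mul1r ltr_nat.
lia.
Qed.

Lemma expc2pi_orthogonality (q : nat) (n : int) : (0 < q)%N ->
  \sum_(j < q) expc2pi (n%:~R / q%:R * j%:R) =
  if (q %| n)%Z then q%:R else 0.
Proof.
move=> q0; under eq_bigr do rewrite expc2pi_muln.
rewrite -expc2pi_eq1 //; case: eqVneq => [->|z1].
  under eq_bigr do rewrite expr1n.
  by rewrite sumr_const card_ord.
apply: (@mulfI _ (expc2pi (n%:~R / q%:R) - 1)); first by rewrite subr_eq0.
rewrite -subrX1 mulr0 -expc2pi_muln divfK ?pnatr_eq0 -?lt0n //.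
by rewrite expc2pi_int subrr.
Qed.

End Exponential.

Lemma cvg_bigsum (K : numFieldType) (V : normedModType K) (I : Type)
    (r : seq I) (S : Type) (Fl : set_system S) (FF : Filter Fl) (P : pred I)
    (f : I -> S -> V) (l : I -> V) :
  (forall i, P i -> f i x @[x --> Fl] --> l i) ->
  (\sum_(i <- r | P i) f i x) @[x --> Fl] --> \sum_(i <- r | P i) l i.
Proof.
move=> h; elim: r => [|i r IH].
  by under eq_fun do rewrite big_nil; rewrite big_nil; exact: cvg_cst.
under eq_fun do rewrite big_cons; rewrite big_cons.
by case: ifPn => // Pi; apply: cvgD => //; exact: h.
Qed.

Section Coefficient.
Variable R : realType.
Implicit Types (Z : 'M[R[i]]_2) (M N T : 'M[R]_2).

Local Notation toC := (map_mx (real_complex R)).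

(* Along this direction the frequency of a half-integral (n, r/2; r/2, n') is
   n + r L + n' L^2, so bounded frequencies are separated modulo L^3. *)
Definition direction (L : nat) : 'M[R]_2 :=
  mx2 1 L%:R L%:R (L ^ 2)%:R.

Definition sample_point (L j : nat) : 'M[R[i]]_2 :=
  'i%:M + toC ((j%:R / (L ^ 3)%:R) *: direction L).

Lemma map_Re_Im (X Y : 'M[R]_2) :
  map_mx (@complex.Im R) (toC X + 'i *: toC Y) = Y.
Proof. by apply/matrixP => i j; rewrite !mxE /= !(mul0r, mul1r, add0r, addr0). Qed.

Lemma H2_sample_point L j : H2 (sample_point L j).
Proof.
rewrite /sample_point; set X := _ *: _.
have -> : 'i%:M + toC X = toC X + 'i *: toC (1%:M).
  by rewrite map_mx1 scalemx1 addrC.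
split; last rewrite map_Re_Im.
  by rewrite raddfD /= linearZ /= !map_trmx trmx1 /X linearZ /= tr_mx2.
split=> [|v v0]; first exact: trmx1.
rewrite mulmx1 mxE lt_neqAle eq_sym sumr_ge0 ?andbT; last first.
  by move=> i _; rewrite mxE -expr2 sqr_ge0.
apply: contraNneq v0 => /eqP; rewrite psumr_eq0; last first.
  by move=> i _; rewrite mxE -expr2 sqr_ge0.
move=> /allP h; apply/eqP/matrixP => i0 j0; rewrite ord1 mxE.
by have := h i0 (mem_index_enum i0); rewrite mxE -expr2 sqrf_eq0 => /eqP.
Qed.

Lemma half_integral_freq M : M^T = M -> half_integral M ->
  exists u v w : int, M = mx2 u%:~R (v%:~R / 2) (v%:~R / 2) w%:~R.
Proof.
move=> Ms [h1 h2].
have /intrP[u eu] := h1 0; have /intrP[w ew] := h1 1.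
have /intrP[v ev] := h2 0 1.
have e10 : M 1 0 = M 0 1 by rewrite -[in LHS]Ms mxE.
exists u, v, w; rewrite (mx2_eta M) e10 eu ew -ev.
by congr mx2; rewrite mulrC mulKf ?pnatr_eq0.
Qed.

Lemma direction_freq (L : nat) (u v w : int) :
  \tr (mx2 u%:~R (v%:~R / 2) (v%:~R / 2) w%:~R *m direction L) =
  (u + v * L%:Z + w * (L ^ 2)%:Z)%:~R :> R.
Proof.
by rewrite /direction mul_mx2 mxtrace2 !intrD !intrM -!pmulrn; field.
Qed.

Lemma multiple_small (d x y : int) : `|x| < d -> x = d * y -> x = 0.
Proof.
move=> xd e; have [y0|[y0|y0]] : y = 0 \/ (1 <= y \/ y <= -1) by lia.
- by rewrite e y0 mulr0.
- nia.
- nia.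
Qed.

(** Base-[L] digits: if [L^3] divides [u + v L + w L^2] and [L] exceeds [|u| + |v| + |w|], then
    reduction modulo [L] gives [u = 0], and division by [L] passes to [v], then to [w]. *)
Lemma freq_separation M : M^T = M -> half_integral M ->
  exists K : nat, forall (L : nat) (n : int), (K < L)%N ->
    n%:~R = \tr (M *m direction L) -> ((L ^ 3)%N %| n)%Z -> M = 0.
Proof.
move=> Ms Mh; have [u [v [w ->]]] := half_integral_freq Ms Mh.
exists (`|u| + `|v| + `|w|)%N => L n KL.
rewrite direction_freq => /intr_inj -> /dvdzP[q eq].
have L0 : L%:Z != 0 by lia.
have u0 : u = 0.
  by apply: (@multiple_small L%:Z _ (q * (L%:Z * L%:Z) - v - w * L%:Z)); lia.
have v0 : v = 0.
  apply: (@multiple_small L%:Z _ (q * L%:Z - w)); first lia.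
  by apply: (mulfI L0); lia.
have w0 : w = 0.
  apply: (@multiple_small L%:Z _ q); first lia.
  by do 2!apply: (mulfI L0); lia.
by apply/matrixP; elim/ord2P; elim/ord2P; rewrite !mxE ?u0 ?v0 ?w0 ?mul0r.
Qed.

Lemma trace_sample_point M L j (n : int) : n%:~R = \tr (M *m direction L) ->
  \tr (toC M *m sample_point L j) =
  \tr (toC M *m 'i%:M) + n%:~R / (L ^ 3)%:R * j%:R.
Proof.
move=> en; rewrite /sample_point mulmxDr raddfD /=; congr (_ + _).
rewrite -map_mxM /= -scalemxAr trace_map_mx mxtraceZ -en.
move: (L ^ 3)%N => q; rewrite !rmorphM /= fmorphV /= !rmorph_nat rmorph_int.
by rewrite mulrC -[RHS]mulrA [_^-1 * _]mulrC.
Qed.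

(** A discrete substitute for the integral of [G(Z) e(-tr(T Z))] over real translations modulo
    periods. *)
Definition fourier_mean (G : 'M[R[i]]_2 -> R[i]) (T : 'M[R]_2) (L : nat) :
    R[i] :=
  ((L ^ 3)%:R)^-1 * \sum_(j < L ^ 3)
    G (sample_point L j) * expc2pi (- \tr (toC T *m sample_point L j)).

Variables (c : 'M[R]_2 -> R[i]) (phi : 'M[R]_2 -> 'M[R]_2) (T N0 : 'M[R]_2).
Variable G : 'M[R[i]]_2 -> R[i].
Hypothesis cvgG : forall Z, H2 Z ->
  partial_sum (fun N => c N * expc2pi (\tr (toC (phi N) *m Z)) : R[i]^o) A
    @[A --> totally] --> (G Z : R[i]^o).
Hypothesis phi_half : forall N, c N != 0 ->
  (phi N)^T = phi N /\ half_integral (phi N).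
Hypothesis T_half : T^T = T /\ half_integral T.
Hypothesis phi_T : forall N, c N != 0 -> phi N = T -> N = N0.
Hypothesis phi_N0 : phi N0 = T.

(** The floor serves as a cast: the trace is an integer as soon as [c N] is nonzero. *)
Definition frequency (N : 'M[R]_2) (L : nat) : int :=
  Num.floor (\tr ((phi N - T) *m direction L)).

(** The term of [G(Z) e(-tr(T Z))] at the base point ['i%:M]. It does not depend on [L]. *)
Definition centered_term (N : 'M[R]_2) : R[i] :=
  c N * expc2pi (\tr (toC (phi N - T) *m 'i%:M)).

Lemma diff_half N : c N != 0 ->
  (phi N - T)^T = phi N - T /\ half_integral (phi N - T).
Proof.
move=> /phi_half[s [h1 h2]]; have [s' [h1' h2']] := T_half.
split; first by rewrite raddfB /= s s'.
split=> [i|i j]; rewrite !mxE ?mulrBr; apply: rpredB => //.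
Qed.

Lemma freqE N L : c N != 0 ->
  (frequency N L)%:~R = \tr ((phi N - T) *m direction L).
Proof.
move=> /diff_half[s h]; have [u [v [w e]]] := half_integral_freq s h.
by rewrite /frequency e direction_freq intrKfloor.
Qed.

Lemma trace_sub M M' Z :
  \tr (toC M *m Z) - \tr (toC M' *m Z) = \tr (toC (M - M') *m Z).
Proof. by rewrite map_mxB mulmxBl raddfB. Qed.

(** Moving the sample point multiplies a term by powers of an [L^3]-th root of unity, so
    orthogonality keeps the whole term or cancels it. *)
Lemma mean_term N L : (0 < L)%N ->
  ((L ^ 3)%:R)^-1 * \sum_(j < L ^ 3)
    c N * expc2pi (\tr (toC (phi N) *m sample_point L j)) *
    expc2pi (- \tr (toC T *m sample_point L j)) =
  if ((L ^ 3)%N %| frequency N L)%Z then centered_term N else 0.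
Proof.
move=> L0; have [c0|c0] := eqVneq (c N) 0.
  rewrite /centered_term c0 big1 ?mulr0 ?mul0r ?if_same // => j _.
  by rewrite !mul0r.
have L30 : (0 < L ^ 3)%N by rewrite expn_gt0 L0.
under eq_bigr => j _.
  rewrite -mulrA -expc2piD trace_sub (trace_sample_point _ (freqE L c0)).
  rewrite expc2piD mulrA.
  over.
rewrite -mulr_sumr expc2pi_orthogonality // -/(centered_term N).
case: ifP => _; last by rewrite !mulr0.
by rewrite mulrC mulfK // pnatr_eq0 -lt0n.
Qed.

Lemma partial_sumE (I : choiceType) (V : zmodType) (f : I -> V) (A : {fset I}) :
  partial_sum f A = \sum_(i <- A) f i.
Proof. by rewrite /partial_sum big_seq_fsetE. Qed.

Lemma cvg_mean L : (0 < L)%N ->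
  partial_sum ((fun N => if ((L ^ 3)%N %| frequency N L)%Z
                         then centered_term N else 0) : _ -> R[i]^o) A
    @[A --> totally] --> (fourier_mean G T L : R[i]^o).
Proof.
move=> L0.
pose S j A := partial_sum (fun N => c N *
  expc2pi (\tr (toC (phi N) *m sample_point L j)) : R[i]^o) A.
have E (A : {fset 'M[R]_2}) :
    partial_sum ((fun N => if ((L ^ 3)%N %| frequency N L)%Z
                           then centered_term N else 0) : _ -> R[i]^o) A =
    ((L ^ 3)%:R)^-1 * \sum_(j < L ^ 3)
      S j A * expc2pi (- \tr (toC T *m sample_point L j)).
  rewrite partial_sumE; under eq_bigr do rewrite -mean_term //.
  rewrite -mulr_sumr exchange_big /=; congr (_ * _).
  by apply: eq_bigr => j _; rewrite /S partial_sumE mulr_suml.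
rewrite (eq_cvg _ _ E).
have FF := @totally_filter (matrix R 2 2 : choiceType).
apply: (@cvgMl_tmp R[i]). apply: cvg_bigsum => j _.
apply: (@cvgMr_tmp R[i]); apply: cvgG; exact: H2_sample_point.
Qed.

End Coefficient.

Lemma partial_sum_near (K : numFieldType) (V : normedModType K)
    (I : choiceType) (f : I -> V) (l : V) (eps : K) :
  partial_sum f A @[A --> totally] --> l -> 0 < eps ->
  exists A0 : {fset I}, forall A : {fset I},
    (A0 `<=` A)%fset -> `|l - \sum_(i <- A) f i| < eps.
Proof.
move=> fl e0; have FF := @totally_filter I.
have [A0 _ hA0] := (cvgrPdist_lt _ _).1 fl _ e0.
by exists A0 => A hA; rewrite -partial_sumE; exact: hA0.
Qed.

(** The Cauchy criterion for nets, from comparing the partial sums over [A0] and over its union with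
    [B]. *)
Lemma partial_sum_tail (K : numFieldType) (V : normedModType K)
    (I : choiceType) (f : I -> V) (l : V) (eps : K) :
  partial_sum f A @[A --> totally] --> l -> 0 < eps ->
  exists A0 : {fset I}, forall B : {fset I},
    (forall i, i \in B -> i \notin A0) -> `|\sum_(i <- B) f i| < eps.
Proof.
move=> fl e0; have e20 : 0 < eps / 2 by rewrite divr_gt0.
have [A0 hA0] := partial_sum_near fl e20.
exists A0 => B hB.
have h1 := hA0 A0 (fsubset_refl _).
have h2 := hA0 (A0 `|` B)%fset (fsubsetUl _ _).
have e : \sum_(i <- (A0 `|` B)%fset) f i =
    \sum_(i <- A0) f i + \sum_(i <- B) f i.
  rewrite (big_fsetID _ (mem A0)) /=; congr (_ + _); apply: eq_fbigl => i.
    by rewrite !inE /= andbC; case: (i \in A0).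
  rewrite !inE /=; case: (boolP (i \in A0)) => //= iA; rewrite ?andbT ?andbF //.
  by apply/esym/negbTE/negP => /hB; rewrite iA.
have -> : \sum_(i <- B) f i =
    (l - \sum_(i <- A0) f i) - (l - \sum_(i <- (A0 `|` B)%fset) f i).
  by rewrite e opprB addrC addrA subrK addrAC subrr add0r.
rewrite (le_lt_trans (ler_normB _ _)) // [ltRHS]splitr.
by rewrite ltrD.
Qed.

Section CoefficientLimit.
Variable R : realType.
Local Notation toC := (map_mx (real_complex R)).
Variables (c : 'M[R]_2 -> R[i]) (phi : 'M[R]_2 -> 'M[R]_2) (T N0 : 'M[R]_2).
Variable G : 'M[R[i]]_2 -> R[i].
Hypothesis cvgG : forall Z, H2 Z ->
  partial_sum (fun N => c N * expc2pi (\tr (toC (phi N) *m Z)) : R[i]^o) A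
    @[A --> totally] --> (G Z : R[i]^o).
Hypothesis phi_half : forall N, c N != 0 ->
  (phi N)^T = phi N /\ half_integral (phi N).
Hypothesis T_half : T^T = T /\ half_integral T.
Hypothesis phi_T : forall N, c N != 0 -> phi N = T -> N = N0.
Hypothesis phi_N0 : phi N0 = T.

Local Notation freq := (frequency phi T).
Local Notation base := (centered_term c phi T).

Lemma H2_i : H2 ('i%:M : 'M[R[i]]_2).
Proof.
have := @H2_sample_point R 0 0; rewrite /sample_point mul0r scale0r map_mx0.
by rewrite addr0.
Qed.

Lemma cvg_base :
  partial_sum (base : _ -> R[i]^o) A @[A --> totally] -->
    (G ('i%:M) * expc2pi (- \tr (toC T *m 'i%:M)) : R[i]^o).
Proof.
have FF := @totally_filter (matrix R 2 2 : choiceType).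
have E : (fun A => partial_sum (base : _ -> R[i]^o) A) =1
   fun A => partial_sum (fun N => c N *
     expc2pi (\tr (toC (phi N) *m 'i%:M)) : R[i]^o) A *
     expc2pi (- \tr (toC T *m 'i%:M)).
  move=> A; rewrite !partial_sumE mulr_suml; apply: eq_bigr => N _.
  by rewrite -mulrA -expc2piD trace_sub.
rewrite (eq_cvg _ _ E); apply: (@cvgMr_tmp R[i]); apply: cvgG; exact: H2_i.
Qed.

Lemma uniform_separation (s : seq 'M[R]_2) : exists K : nat, forall L N,
  (K < L)%N -> N \in s -> c N != 0 -> ((L ^ 3)%N %| freq N L)%Z -> N = N0.
Proof.
elim: s => [|M s [K hK]]; first by exists 0%N.
have [c0|c0] := eqVneq (c M) 0.
  exists K => L N KL; rewrite inE => /orP[/eqP ->|]; last exact: hK.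
  by rewrite c0 eqxx.
have [h1 h2] := diff_half phi_half T_half c0.
have [K' hK'] := freq_separation h1 h2.
exists (maxn K K') => L N; rewrite gtn_max => /andP[KL K'L].
rewrite inE => /orP[/eqP -> _ h|]; last exact: hK.
apply: phi_T => //; apply/eqP; rewrite -subr_eq0; apply/eqP.
exact: (hK' _ _ K'L (freqE phi_half T_half L c0)).
Qed.

(** [A0] and [K] come from the base-point series and are fixed before [n]; only [A1] varies with
    [n]. Past [K], the surviving terms other than [N0] avoid [A0], so any finite sum of them is
    below [eps / 2], whatever the size of [A1]. *)
Theorem fourier_mean_cvg :
  (fourier_mean G T n.+1 : R[i]^o) @[n --> \oo] --> (c N0 : R[i]^o).
Proof.
have FF := @totally_filter (matrix R 2 2 : choiceType).
apply/cvgrPdist_lt => eps e0.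
have e20 : 0 < eps / 2 by rewrite divr_gt0.
have [A0 hA0] := partial_sum_tail cvg_base e20.
have [K hK] := uniform_separation A0.
near=> n.
have KL : (K < n.+1)%N by rewrite ltnS; near: n; exact: nbhs_infty_ge.
have [A1 hA1] := partial_sum_near (cvg_mean cvgG phi_half T_half (ltn0Sn n)) e20.
have := hA1 ([fset N0] `|` A1)%fset (fsubsetUr _ _).
rewrite (big_fsetD1 N0) ?inE ?eqxx //=.
(* [N0] has frequency 0, hence survives for every [L], with trivial exponential factor. *)
have -> : (if ((n.+1 ^ 3)%N %| freq N0 n.+1)%Z then base N0 else 0) = c N0.
  rewrite /centered_term phi_N0 subrr map_mx0 mul0mx mxtrace0 expc2pi0 mulr1.
  have [->|c0] := eqVneq (c N0) 0; first by rewrite if_same.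
  by rewrite /frequency phi_N0 subrr mul0mx mxtrace0 floor0 dvdz0.
set B := (_ `\ N0)%fset.
rewrite -big_mkcond /= => h.
have := hA0 [fset N in B | (c N != 0) && ((n.+1 ^ 3)%N %| freq N n.+1)%Z]%fset.
rewrite -big_fset_condE /=.
have -> : \sum_(N <- B | (c N != 0) && ((n.+1 ^ 3)%N %| freq N n.+1)%Z) base N
    = \sum_(N <- B | ((n.+1 ^ 3)%N %| freq N n.+1)%Z) base N.
  rewrite big_mkcondl; apply: eq_bigr => N _; case: eqVneq => //= c0.
  by rewrite /centered_term c0 mul0r.
move=> h'; have {}h' := h' _.
have -> : c N0 - fourier_mean G T n.+1 =
  - (fourier_mean G T n.+1 - (c N0 +
   \sum_(N <- B | ((n.+1 ^ 3)%N %| freq N n.+1)%Z) base N)) -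
   \sum_(N <- B | ((n.+1 ^ 3)%N %| freq N n.+1)%Z) base N.
  by rewrite opprB addrAC addrK.
rewrite (le_lt_trans (ler_normB _ _)) // [ltRHS]splitr normrN ltrD //.
(* A surviving index inside [A0] would be [N0] by the choice of [K], and [N0] has been removed from
   [B]. *)
apply: h' => N; rewrite !inE /= => /andP[/andP[NN0 _] /andP[c0 d]].
by apply: contra NN0 => NA; apply/eqP; apply: (hK _ _ KL NA c0).
Unshelve. all: by end_near.
Qed.

End CoefficientLimit.

(** * Fourier expansions after an affine substitution *)

Section Expansion.
Variable R : realType.
Local Notation toC := (map_mx (real_complex R)).
Local Notation toR := (map_mx (intr : int -> R)).

Lemma toC_int (m n : nat) (X : 'M[int]_(m, n)) :
  toC (toR X) = map_mx (intr : int -> R[i]) X.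
Proof. by apply/matrixP=> i j; rewrite !mxE rmorph_int. Qed.

Lemma map_Im_affine (A S : 'M[R]_2) (Z : 'M[R[i]]_2) :
  map_mx (@complex.Im R) (toC A *m Z *m toC A^T + toC S) =
  A *m map_mx (@complex.Im R) Z *m A^T.
Proof.
apply/matrixP => i j; rewrite !mxE !big_ord_recl !big_ord0 !mxE.
rewrite !big_ord_recl !big_ord0 !mxE.
do !case: (Z _ _) => ? ? /=; ring.
Qed.

Lemma H2_affine (s : nat) (A S : 'M[R]_2) (Z : 'M[R[i]]_2) :
  (0 < s)%N -> A \in unitmx -> S^T = S -> H2 Z ->
  H2 (s%:R *: (toC A *m Z *m toC A^T) + toC S).
Proof.
move=> s0 Au Ss [Zs [Ys Yp]]; have s0' : 0 < s%:R :> R by rewrite ltr0n.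
have Ys' : map_mx (@complex.Im R) (s%:R *: (toC A *m Z *m toC A^T) + toC S)
  = s%:R *: (A *m map_mx (@complex.Im R) Z *m A^T).
  rewrite -(map_Im_affine A 0); apply/matrixP => i j; rewrite !mxE.
  rewrite -[s%:R in LHS](rmorph_nat (real_complex R)).
  by case: (\sum_j _) => x y /=; ring.
split; last rewrite Ys'.
  rewrite linearD linearZ /= !trmx_mul !map_trmx trmxK Zs Ss.
  by rewrite -map_trmx mulmxA.
split=> [|v v0]; first by rewrite linearZ /= !trmx_mul trmxK Ys mulmxA.
rewrite -scalemxAr -scalemxAl mxE mulr_gt0 //.
rewrite !mulmxA -(mulmxA _ A^T) -[v^T *m A]trmxK trmx_mul trmxK.
apply: Yp; apply: contra v0 => /eqP e.
by rewrite -[v](mulKmx (_ : A^T \in unitmx)) ?unitmx_tr // e mulmx0.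
Qed.

Lemma possemidef_gram (s : R) (D : 'M[R]_2) : 0 <= s ->
  possemidef (s *: (D *m D^T)).
Proof.
move=> s0; split; first by rewrite linearZ /= trmx_mul trmxK.
move=> v; rewrite -scalemxAr -scalemxAl mxE mulr_ge0 //.
rewrite !mulmxA -(mulmxA _ D^T) -[v^T *m D]trmxK trmx_mul trmxK mxE.
by rewrite sumr_ge0 // => i _; rewrite mxE -expr2 sqr_ge0.
Qed.

Lemma half_integral_mx2 (u v w : int) :
  half_integral (mx2 u%:~R (v%:~R / 2) (v%:~R / 2) w%:~R : 'M[R]_2).
Proof.
have h : 2 * (v%:~R / 2) = v%:~R :> R by rewrite mulrC divfK ?pnatr_eq0.
split; first by elim/ord2P; rewrite mxE /= intr_int.
by elim/ord2P; elim/ord2P; rewrite mxE /= ?h ?intr_int // -[2]/(2%:~R) -intrM intr_int.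
Qed.

Lemma half_integral_congr (s : nat) (A : 'M[int]_2) (N : 'M[R]_2) :
  N^T = N -> half_integral N ->
  let M := s%:R *: ((toR A)^T *m N *m toR A) in
  M^T = M /\ half_integral M.
Proof.
move=> Ns Nh M; split; first by rewrite linearZ /= !trmx_mul trmxK Ns mulmxA.
rewrite /M; have [u [v [w ->]]] := half_integral_freq Ns Nh.
rewrite (mx2_eta A) !mx2E.
move: (A 0 0) (A 0 1) (A 1 0) (A 1 1) => a b c d.
set X := mx2 _ _ _ _.
have -> : X = mx2 (s%:Z * (a * a * u + a * c * v + c * c * w))%:~R
  ((s%:Z * (2 * a * b * u + (a * d + b * c) * v + 2 * c * d * w))%:~R / 2)
  ((s%:Z * (2 * a * b * u + (a * d + b * c) * v + 2 * c * d * w))%:~R / 2)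
  (s%:Z * (b * b * u + b * d * v + d * d * w))%:~R.
  by rewrite /X; congr mx2; rewrite !(intrM, intrD) -!pmulrn; field.
exact: half_integral_mx2.
Qed.

Lemma fourier_indexP (N : 'M[R]_2) : N \in @fourier_index R ->
  N^T = N /\ half_integral N.
Proof. by rewrite inE => -[h [s _]]. Qed.

(** The expansion says nothing about [a] off [fourier_index], yet matrices such as [D D^T / m] may
    fall outside; there the true coefficient is 0. *)
Definition coefficient (a : 'M[R]_2 -> R[i]) (N : 'M[R]_2) : R[i] :=
  if N \in @fourier_index R then a N else 0.

(** The substitution sends the index [N] to the frequency [s A^T N A] and multiplies its coefficient
    by [e(tr(N S))]; as [A] is invertible, [T] comes from [N0] alone. It is used with [s = m],
    [A = 1] for [F(m Z)], and with [s = 1] for coset terms and unimodular changes of variable. *)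
Lemma coefficient_cvg (a : 'M[R]_2 -> R[i]) (F : 'M[R[i]]_2 -> R[i])
    (s : nat) (A : 'M[int]_2) (S T N0 : 'M[R]_2) :
  fourier_expansion a F ->
  (0 < s)%N -> toR A \in unitmx -> S^T = S -> T^T = T /\ half_integral T ->
  s%:R *: ((toR A)^T *m N0 *m toR A) = T ->
  (fourier_mean (fun Z =>
     F (s%:R *: (toC (toR A) *m Z *m toC (toR A)^T) + toC S)) T n.+1 : R[i]^o)
    @[n --> \oo] -->
  (coefficient a N0 * expc2pi (\tr (toC (N0 *m S))) : R[i]^o).
Proof.
move=> aF s0 Au Ss Th hN0.
pose c N := coefficient a N * expc2pi (\tr (toC (N *m S))).
have cidx N : c N != 0 -> N \in @fourier_index R.
  by apply: contraNT => h; rewrite /c /coefficient (negPf h) mul0r.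
have s0' : s%:R != 0 :> R by rewrite pnatr_eq0 -lt0n.
have Atu : (toR A)^T \in unitmx by rewrite unitmx_tr.
have := @fourier_mean_cvg R c
  (fun N => s%:R *: ((toR A)^T *m N *m toR A)) T N0 (fun Z =>
     F (s%:R *: (toC (toR A) *m Z *m toC (toR A)^T) + toC S)).
apply.
- move=> Z HZ; set Z' := _ + _.
  have -> : (fun N => c N * expc2pi
      (\tr (toC (s%:R *: ((toR A)^T *m N *m toR A)) *m Z)) : R[i]^o) =
      (fourier_term a Z' : 'M[R]_2 -> R[i]^o).
    apply/funext => N; rewrite /fourier_term /c /coefficient -/(expc2pi _).
    case: ifP => _; last by rewrite !mul0r.
    rewrite -mulrA; congr (_ * _); rewrite -expc2piD; congr expc2pi.
    rewrite /Z' mulmxDr raddfD /= addrC; congr (_ + _).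
      rewrite -scalemxAr map_mxZ -scalemxAl !mxtraceZ rmorph_nat; congr (_ * _).
      by rewrite !map_mxM -!mulmxA [LHS]mxtrace_mulC !mulmxA.
    by rewrite map_mxM.
  exact: aF (H2_affine s0 Au Ss HZ).
- by move=> N /cidx/fourier_indexP[Ns Nh]; exact: half_integral_congr.
- by [].
- move=> N _; rewrite -hN0 => /(scalerI s0').
  by move=> /(can_inj (mulmxK Au))/(can_inj (mulKmx Atu)).
- exact: hN0.
Qed.

End Expansion.

(** * The eigenvalue as a sum over coset representatives *)

Section UpperTriangular.
Variable R : realType.
Local Notation toRC := (map_mx (real_complex R)).
Local Notation toR := (map_mx (intr : int -> R)).
Variables (m : nat) (A B D : 'M[int]_2).
Hypothesis m_gt0 : (0 < m)%N.
Hypothesis AD : A^T *m D = (m%:Z)%:M.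
Hypothesis BD : B^T *m D = D^T *m B.

Lemma real_unit : toR A \in unitmx /\ toR D \in unitmx.
Proof.
have mu : (m%:R%:M : 'M[R]_2) \in unitmx.
  by rewrite unitmxE det_scalar unitfE expf_neq0 // pnatr_eq0 -lt0n.
have e : (toR A)^T *m toR D = m%:R%:M.
  by rewrite map_trmx -map_mxM AD map_scalar_mx.
by move: mu; rewrite -e unitmx_mul unitmx_tr => /andP[].
Qed.

Definition translation : 'M[R]_2 := toR B *m invmx (toR D).

Lemma translation_sym : translation^T = translation.
Proof.
have [_ Du] := real_unit; rewrite /translation trmx_mul trmx_inv.
have e := congr1 (map_mx (intr : int -> R)) BD.
rewrite !map_mxM -!map_trmx in e.
rewrite -[(toR B)^T](mulmxK Du) e !mulmxA mulVmx ?unitmx_tr // mul1mx.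
by [].
Qed.

(** From [A^T D = m] one gets [D^-1 = A^T / m], whose denominator is absorbed by the scaling of
    [Z]. *)
Lemma upper_action (Z : 'M[R[i]]_2) :
  (toC R A *m (m%:R *: Z) + toC R B) *m invmx (toC R D) =
  1%:R *: (toRC (toR A) *m Z *m toRC (toR A)^T) + toRC translation.
Proof.
have [_ Du] := real_unit.
have e : invmx (toR D) = m%:R^-1 *: (toR A)^T.
  have e : (toR A)^T *m toR D = m%:R%:M.
    by rewrite map_trmx -map_mxM AD map_scalar_mx.
  rewrite -[(toR A)^T](mulmxK Du) e mul_scalar_mx scalerA mulVf ?scale1r //.
  by rewrite pnatr_eq0 -lt0n.
rewrite scale1r /translation map_mxM map_invmx !toC_int mulmxDl; congr (_ + _).
have -> : invmx (toC R D) = m%:R^-1 *: toRC (toR A)^T.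
  rewrite -toC_int -map_invmx e map_mxZ fmorphV /= rmorph_nat.
  by [].
by rewrite -!scalemxAr -scalemxAl scalerA mulVf ?scale1r ?pnatr_eq0 -?lt0n //.
Qed.

Lemma slash_upper (k : int) (F : 'M[R[i]]_2 -> R[i]) (Z : 'M[R[i]]_2) :
  slash k (block_mx A B 0 D) F (m%:R *: Z) =
  \det (toC R D) ^ (- k) *
  F (1%:R *: (toRC (toR A) *m Z *m toRC (toR A)^T) + toRC translation).
Proof. by rewrite slash_block map_mx0 mul0mx add0r upper_action. Qed.

Lemma slash_left_coset (k : int) (F : 'M[R[i]]_2 -> R[i]) (Z : 'M[R[i]]_2) :
  siegel_modular_form k F -> H2 Z ->
  slash k (representative (left_coset (block_mx A B 0 D))) F (m%:R *: Z) =
  \det (toC R D) ^ (- k) *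
  F (1%:R *: (toRC (toR A) *m Z *m toRC (toR A)^T) + toRC translation).
Proof.
move=> Fk HZ; have [Au Du] := real_unit.
have [] : left_coset (block_mx A B 0 D)
    (representative (left_coset (block_mx A B 0 D))).
  apply: (@representativeP _ (block_mx A B 0 D)).
  by exists 1%:M; [exact: Gamma1|rewrite mul1mx].
move=> g hg <-; rewrite slash_Gamma //; first exact: slash_upper.
  by rewrite -unitfE -unitmxE -toC_int map_unitmx.
by rewrite upper_action; exact: H2_affine translation_sym HZ.
Qed.

(** This singles out [D D^T / m] as the index with frequency [m I]: both [A^T D] and [D^T A] equal
    [m]. *)
Lemma gram_congr :
  1%:R *: ((toR A)^T *m (m%:R^-1 *: (toR D *m (toR D)^T)) *m toR A) =
  m%:R%:M :> 'M[R]_2.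
Proof.
have e : (toR A)^T *m toR D = m%:R%:M.
  by rewrite map_trmx -map_mxM AD map_scalar_mx.
have e' : (toR D)^T *m toR A = m%:R%:M.
  by apply: trmx_inj; rewrite trmx_mul trmxK e tr_scalar_mx.
rewrite scale1r -scalemxAr -scalemxAl mulmxA e mul_scalar_mx -scalemxAl e'.
rewrite !scalerA mulVf ?scale1r ?pnatr_eq0 -?lt0n //.
Qed.

Lemma trace_translation :
  \tr (m%:R^-1 *: (toR D *m (toR D)^T) *m translation) =
  (\tr (D^T *m B))%:~R / m%:R.
Proof.
have [_ Du] := real_unit.
rewrite -scalemxAl mxtraceZ mulrC; congr (_ / _).
rewrite /translation mulmxA mxtrace_mulC !mulmxA mulVmx // mul1mx.
by rewrite map_trmx -map_mxM trace_map_mx.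
Qed.

End UpperTriangular.

Lemma fourier_mean_sum (R : realType) (I : Type) (r : seq I) (P : pred I)
    (x : I -> R[i]) (G : I -> 'M[R[i]]_2 -> R[i]) (H : 'M[R[i]]_2 -> R[i])
    (T : 'M[R]_2) (L : nat) :
  (forall Z, H2 Z -> H Z = \sum_(i <- r | P i) x i * G i Z) ->
  fourier_mean H T L = \sum_(i <- r | P i) x i * fourier_mean (G i) T L.
Proof.
move=> h; rewrite /fourier_mean.
under eq_bigr => j _.
  rewrite h; last exact: H2_sample_point.
  rewrite mulr_suml; under eq_bigr do rewrite -mulrA.
  over.
rewrite exchange_big mulr_sumr /=; apply: eq_bigr => i _.
by rewrite -mulr_sumr mulrCA.
Qed.

Lemma fourier_mean_scale (R : realType) (x : R[i]) (G H : 'M[R[i]]_2 -> R[i])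
    (T : 'M[R]_2) (L : nat) :
  (forall Z, H2 Z -> H Z = x * G Z) ->
  fourier_mean H T L = x * fourier_mean G T L.
Proof.
move=> h; rewrite (@fourier_mean_sum R unit [:: tt] xpredT (fun=> x) (fun=> G) H).
  by rewrite big_seq1.
by move=> Z HZ; rewrite big_seq1 h.
Qed.

Lemma mx2_0 (T : pzRingType) : mx2 0 0 0 0 = 0 :> 'M[T]_2.
Proof. by apply/matrixP; elim/ord2P; elim/ord2P; rewrite !mxE. Qed.

Lemma coefficient1 (R : realType) (a : 'M[R]_2 -> R[i]) :
  coefficient a 1%:M = a 1%:M.
Proof.
rewrite /coefficient ifT // inE; split.
  by rewrite scalar_mx2; have := half_integral_mx2 R 1 0 1; rewrite mul0r.
rewrite -[1%:M]scale1r -[1%:M in X in possemidef X]mulmx1 -[X in _ *m X]trmx1.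
exact: possemidef_gram.
Qed.

Section EigenvalueSum.
Variables (R : realType) (k : int) (F : 'M[R[i]]_2 -> R[i]).
Variables (a : 'M[R]_2 -> R[i]) (m : nat).
Local Notation ord := 'I_m.+1.
Local Notation index := (ord * ord * ord * ord * ord * ord)%type.

(** [b1] stands last so that its sum is innermost and is evaluated first. *)
Definition index_valid (x : index) : bool :=
  let: (d1, d2, t, b2, b4, b1) := x in coset_index m d1 d2 t b1 b2 b4.
Definition index_rep (x : index) : 'M[int]_(2 + 2) :=
  let: (d1, d2, t, b2, b4, b1) := x in coset_rep m d1 d2 t b1 b2 b4.

(** This is [det(D)^-k a(D D^T / m) e(tr(D^T B) / m)] with the matrices written out. *)
Definition index_term (d1 d2 t b2 b4 b1 : nat) : R[i] :=
  (d1 * d2)%:R ^ (- k) *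
  (coefficient a (m%:R^-1 *: (mx2 (d1 ^ 2)%:R (d1 * t)%:R (d1 * t)%:R
                                  (t ^ 2 + d2 ^ 2)%:R)) *
   expc2pi ((d1 * b1 + t * ((d1 * b2 + t * b4) %/ d2) + d2 * b4)%:R / m%:R)).

Definition slash_index (x : index) (Z : 'M[R[i]]_2) : R[i] :=
  slash k (representative (left_coset (index_rep x))) F (m%:R *: Z).

Lemma scalar_half : (m%:R%:M)^T = m%:R%:M :> 'M[R]_2 /\
  half_integral (m%:R%:M : 'M[R]_2).
Proof.
split; first exact: tr_scalar_mx.
by rewrite scalar_mx2; have := half_integral_mx2 R m 0 m; rewrite mul0r.
Qed.

Lemma slash_index_cvg (d1 d2 t b2 b4 b1 : ord) :
  siegel_modular_form k F -> fourier_expansion a F -> (0 < m)%N ->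
  coset_index m d1 d2 t b1 b2 b4 ->
  (fourier_mean (slash_index (d1, d2, t, b2, b4, b1)) m%:R%:M n.+1 : R[i]^o)
    @[n --> \oo] --> (index_term d1 d2 t b2 b4 b1 : R[i]^o).
Proof.
move=> Fk aF m0 hx.
have [a1 [a2 [u [b3 [h1 h2 h3 h4 e]]]]] := coset_indexP hx.
have d2_gt0 : (0 < d2)%N by lia.
pose A := mx2 a1%:Z (- u%:Z) 0 a2%:Z.
pose B := mx2 (Posz b1) (Posz b2) (Posz b3) (Posz b4).
pose D := mx2 (Posz d1) 0 (Posz t) (Posz d2).
have AD : A^T *m D = (m%:Z)%:M.
  by rewrite /A /D !mx2E; congr mx2; lia.
have BD : B^T *m D = D^T *m B by rewrite /B /D !mx2E; congr mx2; lia.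
have [Au _] := real_unit R m0 AD.
have E n : fourier_mean (slash_index (d1, d2, t, b2, b4, b1)) m%:R%:M n.+1 =
    (d1 * d2)%:R ^ (- k) * fourier_mean (fun Z =>
      F (1%:R *: (map_mx (real_complex R) (map_mx intr A) *m Z *m
                  map_mx (real_complex R) (map_mx intr A)^T)
         + map_mx (real_complex R) (translation R B D))) m%:R%:M n.+1.
  apply: fourier_mean_scale => Z HZ.
  rewrite /slash_index /index_rep e mx2_0.
  rewrite (slash_left_coset m0 AD BD Fk HZ); congr (_ ^ _ * _).
  by rewrite /D !mx2E mul0r subr0 -intrM.
rewrite (eq_cvg _ _ E).
have := coefficient_cvg aF (ltn0Sn 0) Au (translation_sym R m0 AD BD)
  scalar_half (gram_congr R m0 AD).
have -> : \tr (map_mx (real_complex R) (m%:R^-1 *: (map_mx intr D *m (map_mx intr D)^T) *m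
    translation R B D)) = (d1 * b1 + t * b3 + d2 * b4)%:R / m%:R.
  rewrite trace_map_mx (trace_translation R B m0 AD).
  have -> : \tr (D^T *m B) = (d1 * b1 + t * b3 + d2 * b4)%:Z.
    by rewrite /B /D !mx2E; lia.
  rewrite -pmulrn; move: (_ + _ + _)%N => q.
  by rewrite rmorphM /= fmorphV /= !rmorph_nat.
have -> : map_mx intr D *m (map_mx intr D)^T = mx2 (d1 ^ 2)%:R (d1 * t)%:R
    (d1 * t)%:R (t ^ 2 + d2 ^ 2)%:R :> 'M[R]_2.
  rewrite /D map_mx2 tr_mx2 mul_mx2 -!pmulrn.
  by congr mx2; rewrite !(natrD, natrM, natrX); ring.
have -> : index_term d1 d2 t b2 b4 b1 = (d1 * d2)%:R ^ (- k) *
  (coefficient a (m%:R^-1 *: (mx2 (d1 ^ 2)%:R (d1 * t)%:R (d1 * t)%:R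
                                  (t ^ 2 + d2 ^ 2)%:R)) *
   expc2pi ((d1 * b1 + t * b3 + d2 * b4)%:R / m%:R)).
  by rewrite /index_term -h4 mulnK.
move: (fourier_mean _ _) => f h; exact: (cvgMl_tmp h).
Qed.

(** In [lambda F = T(m) F], taken at [m Z], the coefficients at frequency [m I] are compared: the
    left side yields [lambda a(I) = lambda], and the limit of the means is unique. *)
Theorem eigenvalue_sum : eigenform k F -> fourier_expansion a F ->
  a 1%:M = 1 -> (0 < m)%N ->
  hecke_eigenvalue k F m = m%:R ^ (2 * k - 3) *
    \sum_(x : index | index_valid x)
      (let: (d1, d2, t, b2, b4, b1) := x in index_term d1 d2 t b2 b4 b1).
Proof.
move=> [Fk [Z1 HZ1 FZ1] Fe] aF a1 m0.
(* An eigenvalue exists, so [xget] does not return its default 0. *)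
have lamP : is_hecke_eigenvalue k F m (hecke_eigenvalue k F m).
  by rewrite /hecke_eigenvalue; case: xgetP => // h; have [l /h] := Fe m m0.
move: (hecke_eigenvalue k F m) lamP => lam lamP.
have index_inj x y : index_valid x -> index_valid y ->
    left_coset (index_rep x) = left_coset (index_rep y) -> x = y.
  case: x y => [[[[[d1 d2] t] b2] b4] b1] [[[[[d1' d2'] t'] b2'] b4'] b1'].
  move=> hx hy /(coset_rep_inj m0 hx hy)[h1 h2 h3 [h4 h5 h6]].
  by do !congr pair; apply: val_inj.
have index_surj M : symplectic_similitude m%:Z M ->
    exists2 x, index_valid x & left_equiv M (index_rep x).
  move=> /(coset_rep_exists m0)[d1 [d2 [t [b1 [b2 [b4 [hx hM]]]]]]].
  have /and5P[/(dvdn_leq m0) ? /(dvdn_leq m0) ? _ _ /and4P[? ? ? ?]] := hx.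
  exists (inord d1, inord d2, inord t, inord b2, inord b4, inord b1);
    by rewrite /index_valid /index_rep !inordK //; lia.
have index_sim x : index_valid x -> symplectic_similitude m%:Z (index_rep x).
  by case: x => [[[[[d1 d2] t] b2] b4] b1]; exact: coset_rep_similitude.
have mZ (Z : 'M[R[i]]_2) : H2 Z -> H2 (m%:R *: Z).
  move=> HZ; have := @H2_affine R m 1%:M 0 Z m0 (unitmx1 _ _) (trmx0 _ _ _) HZ.
  by rewrite trmx1 map_mx1 map_mx0 mul1mx mulmx1 addr0.
have I0 : m%:R *: ((map_mx intr (1%:M : 'M[int]_2))^T *m 1%:M *m
    map_mx intr (1%:M : 'M[int]_2)) = m%:R%:M :> 'M[R]_2.
  by rewrite map_mx1 trmx1 !mulmx1 scalemx1.
have Iu : map_mx intr (1%:M : 'M[int]_2) \in (unitmx : pred 'M[R]_2).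
  by rewrite map_mx1 unitmx1.
have lim1 := coefficient_cvg aF m0 Iu (trmx0 _ _ _) scalar_half I0.
rewrite mulmx0 map_mx0 mxtrace0 expc2pi0 mulr1 coefficient1 a1 in lim1.
have E n : lam * fourier_mean (fun Z => F (m%:R *:
      (map_mx (real_complex R) (map_mx intr (1%:M : 'M[int]_2)) *m Z *m
       map_mx (real_complex R) (map_mx intr (1%:M : 'M[int]_2))^T) + 0)) m%:R%:M n.+1 =
    \sum_(x : index | index_valid x) m%:R ^ (2 * k - 3) *
      fourier_mean (slash_index x) m%:R%:M n.+1.
  rewrite -(fourier_mean_scale (H := fun Z => lam * F (m%:R *: Z))).
    apply: fourier_mean_sum => Z HZ.
    by rewrite -lamP ?(hecke_sum _ _ m0 index_sim index_inj index_surj)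
      ?mulr_sumr //; exact: mZ.
  by move=> Z _; rewrite !map_mx1 trmx1 map_mx1 mul1mx mulmx1 addr0.
have lim2 : ((\sum_(x : index | index_valid x) m%:R ^ (2 * k - 3) *
    fourier_mean (slash_index x) m%:R%:M n.+1) : R[i]^o) @[n --> \oo] -->
    (lam * 1 : R[i]^o).
  rewrite -(eq_cvg _ _ E).
  by apply: (@cvgMl_tmp R[i]); exact: lim1.
rewrite -[LHS]mulr1 mulr_sumr; apply: (norm_cvg_unique lim2).
apply: (@cvg_bigsum R[i] R[i]^o) => x hx.
apply: (@cvgMl_tmp R[i]).
case: x hx => [[[[[d1 d2] t] b2] b4] b1] hx.
exact: slash_index_cvg.
Qed.

End EigenvalueSum.

(** * Unimodular invariance of the Fourier coefficients *)

Section Invariance.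
Variables (R : realType) (k : int) (F : 'M[R[i]]_2 -> R[i]).
Variable a : 'M[R]_2 -> R[i].
Hypothesis Fk : siegel_modular_form k F.
Hypothesis aF : fourier_expansion a F.
Local Notation toR := (map_mx (intr : int -> R)).
Local Notation toRC := (map_mx (real_complex R)).

(** Modularity under [(U, 0; 0, U^-T)] says [F(U Z U^T) = F(Z)]; determinant one keeps the
    automorphy factor equal to 1 for odd [k] too. Both sides are then read at the frequency
    [U^T N U]. *)
Lemma coefficient_unimodular (x y z w : int) (N : 'M[R]_2) :
  x * w - y * z = 1 -> N^T = N -> half_integral N ->
  coefficient a ((toR (mx2 x y z w))^T *m N *m toR (mx2 x y z w)) =
  coefficient a N.
Proof.
move=> det1 Ns Nh; set U := mx2 x y z w.
pose D := mx2 w (- z) (- y) x.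
have UD : U^T *m D = (1%:Z)%:M.
  by rewrite /U /D !mx2E; congr mx2; lia.
have [Uu _] := real_unit R (ltn0Sn 0) UD.
have UG : Gamma (block_mx U 0 0 D).
  apply/GammaE; rewrite -!mx2_0; apply/similitude_mx2.
  by split; [lia|lia|lia|lia|split; lia].
have Th := half_integral_congr 1 U Ns Nh.
have lim1 := coefficient_cvg aF (ltn0Sn 0) Uu (trmx0 _ _ _) Th (erefl _).
have Iu : toR (1%:M : 'M[int]_2) \in unitmx by rewrite map_mx1 unitmx1.
have I0 : 1%:R *: ((toR (1%:M : 'M[int]_2))^T *m
    (1%:R *: ((toR U)^T *m N *m toR U)) *m toR (1%:M : 'M[int]_2)) =
    1%:R *: ((toR U)^T *m N *m toR U).
  by rewrite !scale1r map_mx1 trmx1 mul1mx mulmx1.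
have lim2 := coefficient_cvg aF (ltn0Sn 0) Iu (trmx0 _ _ _) Th I0.
have E n : fourier_mean (fun Z =>
      F (1%:R *: (toRC (toR U) *m Z *m toRC (toR U)^T) + toRC 0))
      (1%:R *: ((toR U)^T *m N *m toR U)) n.+1 =
    fourier_mean (fun Z => F (1%:R *: (toRC (toR (1%:M : 'M[int]_2)) *m Z *m
      toRC (toR (1%:M : 'M[int]_2))^T) + toRC 0))
      (1%:R *: ((toR U)^T *m N *m toR U)) n.+1.
  rewrite -[RHS]mul1r; apply: fourier_mean_scale => Z HZ.
  have [_ /(_ _ _ UG HZ)] := Fk.
  have := slash_upper 0 (ltn0Sn 0) UD k F Z.
  rewrite scale1r => ->.
  have -> : \det (map_mx intr D) = 1 :> R[i].
    by rewrite det_map_mx /D !mx2E; rewrite (_ : _ - _ = 1) ?rmorph1 //; lia.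
  rewrite exp1rz mul1r /translation map_mx0 mul0mx => ->.
  by rewrite mul1r !map_mx1 trmx1 map_mx1 mul1mx mulmx1 scale1r map_mx0 addr0.
rewrite (funext E) in lim1; have := norm_cvg_unique lim1 lim2.
rewrite !mulmx0 !map_mx0 !mxtrace0 expc2pi0 !mulr1 scale1r => ->.
by [].
Qed.

Lemma integral_form_half (x y z : int) (s : nat) :
  let N := s%:R *: mx2 x%:~R y%:~R y%:~R z%:~R : 'M[R]_2 in
  N^T = N /\ half_integral N.
Proof.
rewrite /= linearZ /= tr_mx2; split=> //.
rewrite scale_mx2.
have -> : s%:R * y%:~R = (2 * s%:Z * y)%:~R / 2 :> R.
  by rewrite !intrM -!pmulrn; field.
by rewrite pmulrn -!intrM; exact: half_integral_mx2.
Qed.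

(* Reduction theory: translate y into [0, z), then swap x and z. *)
Lemma coefficient_unit_form (s : nat) (x y z : int) :
  0 < z -> x * z - y * y = 1 ->
  coefficient a (s%:R *: mx2 x%:~R y%:~R y%:~R z%:~R) =
  coefficient a s%:R%:M.
Proof.
have [n] := ubnP `|z|%N; elim: n x y z => // n IH x y z zn z0 xz.
have shift (q : int) : coefficient a (s%:R *: mx2 x%:~R y%:~R y%:~R z%:~R) =
    coefficient a (s%:R *: mx2 (x + 2 * q * y + q * q * z)%:~R (y + q * z)%:~R
                               (y + q * z)%:~R z%:~R).
  have [Ns Nh] := integral_form_half x y z s.
  rewrite -(@coefficient_unimodular 1 0 q 1 _ _ Ns Nh); last by lia.
  congr coefficient; rewrite !mx2E.
  by congr mx2; rewrite ?(intrM, intrD); ring.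
have [q /andP[q0 qz]] := residue_exists y z0.
rewrite (shift q).
have xz' : (x + 2 * q * y + q * q * z) * z - (y + q * z) * (y + q * z) = 1.
  by rewrite -[RHS]xz; ring.
move: (x + _ + _) (y + q * z) xz' q0 qz => {shift xz}x {}y xz y0 yz.
(* For [z > 1], [y <= z - 1] gives [x z = y^2 + 1 < z^2], so [x < z] and the swap makes the descent
   strict. *)
have [z1|z1] := eqVneq z 1.
  have -> : y = 0 by lia.
  have -> : x = 1 by nia.
  by rewrite z1 scale_mx2 !mulr0 !mulr1 -scalar_mx2.
have [Ns Nh] := integral_form_half x y z s.
rewrite -(@coefficient_unimodular 0 (-1) 1 0 _ _ Ns Nh); last by lia.
rewrite -(IH z (- y) x); [|nia|nia|lia].
congr coefficient; rewrite !mx2E.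
by congr mx2; rewrite ?intrN; ring.
Qed.

End Invariance.

(** * Character sums *)

Lemma big_ord_seq (V : nmodType) (n : nat) (P : pred nat) (s : seq nat)
    (f : nat -> V) : uniq s -> (forall t, (t \in s) = (t < n)%N && P t) ->
  \sum_(t < n | P t) f t = \sum_(t <- s) f t.
Proof.
move=> us hs; rewrite -(big_mkord P) -big_filter; apply: perm_big.
rewrite uniq_perm ?filter_uniq ?iota_uniq // => t.
by rewrite hs mem_filter mem_index_iota andbC.
Qed.

Lemma big_ord_multiples (V : nmodType) (d e : nat) (f : nat -> V) : (0 < d)%N ->
  \sum_(t < d * e | (d %| t)%N) f t = \sum_(t < e) f (d * t)%N.
Proof.
move=> d0; rewrite (@big_ord_seq _ _ (fun t => d %| t)%N [seq (d * t)%N | t <- iota 0 e]).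
- by rewrite big_map -(big_mkord xpredT (fun t => f (d * t)%N)) /index_iota subn0.
- rewrite map_inj_uniq ?iota_uniq // => x y /eqP.
  by rewrite eqn_pmul2l // => /eqP.
- move=> t; apply/mapP/andP => [[x]|[te /dvdnP[x ex]]].
    by rewrite mem_iota => /andP[_ xe] ->; rewrite dvdn_mulr // ltn_pmul2l.
  exists x; last by rewrite ex mulnC.
  by rewrite mem_iota /= -(ltn_pmul2l d0) mulnC -ex.
Qed.

Lemma big_prod_type (V : nmodType) (A B : finType) (f : A * B -> V) :
  \sum_p f p = \sum_x \sum_y f (x, y).
Proof. by rewrite pair_bigA; apply: eq_bigr => -[]. Qed.

Lemma big_ord_lt (V : nmodType) (m d : nat) (f : nat -> V) : (d <= m)%N ->
  \sum_(b < m | (b < d)%N) f b = \sum_(b < d) f b.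
Proof. by move=> dm; rewrite [RHS](big_ord_widen _ _ dm). Qed.

Section CharacterSums.
Variable R : realType.

(** Since [m] divides [d c], the fraction [c / m] has denominator [d], and the sum runs over a full
    period of the character. *)
Lemma expc2pi_sum_ord (d m c : nat) : (0 < d)%N -> (0 < m)%N ->
  (m %| d * c)%N ->
  \sum_(b < d) expc2pi ((c * b)%:R / m%:R : R[i]) =
  if (m %| c)%N then d%:R else 0.
Proof.
move=> d0 m0 /dvdnP[n dc].
have d0' : d%:R != 0 :> R[i] by rewrite pnatr_eq0 -lt0n.
have m0' : m%:R != 0 :> R[i] by rewrite pnatr_eq0 -lt0n.
have e (b : nat) : (c * b)%:R / m%:R = (n%:Z)%:~R / d%:R * b%:R :> R[i].
  have dc' : d%:R * c%:R = n%:R * m%:R :> R[i] by rewrite -!natrM dc.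
  have ec : c%:R = n%:R * m%:R / d%:R :> R[i] by rewrite -dc' mulrC mulKf.
  by rewrite natrM -pmulrn ec; field; rewrite m0' d0'.
under eq_bigr do rewrite e.
rewrite expc2pi_orthogonality //; congr (if _ then _ else _).
have -> : (d %| n%:Z)%Z = (d %| n)%N by [].
by rewrite -(@dvdn_pmul2r m) // -dc dvdn_pmul2l.
Qed.

Lemma int_num_dvdn (m q : nat) : (0 < m)%N ->
  m%:R^-1 * q%:R \is a @Num.int R -> (m %| q)%N.
Proof.
move=> m0 /intrP[n e]; have m0' : m%:R != 0 :> R by rewrite pnatr_eq0 -lt0n.
have : q%:R = n%:~R * m%:R :> R by rewrite -e mulrC mulrA divff // mul1r.
rewrite !pmulrn -intrM => /intr_inj h.
by have := dvdz_mull n (dvdzz m%:Z); rewrite -h.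
Qed.

(** Integrality of the diagonal on the support of the coefficient. These divisibilities are what
    makes the sums over [b1] and [b4] complete character sums. *)
Lemma coefficient_gram_neq0 (a : 'M[R]_2 -> R[i]) (m x y z : nat) :
  (0 < m)%N ->
  coefficient a (m%:R^-1 *: mx2 x%:R y%:R y%:R z%:R) != 0 ->
  (m %| x)%N /\ (m %| z)%N.
Proof.
move=> m0 h; have : m%:R^-1 *: mx2 x%:R y%:R y%:R z%:R \in @fourier_index R.
  by apply: contraNT h => h; rewrite /coefficient (negPf h).
move=> /fourier_indexP[_ [h1 _]].
by split; apply: int_num_dvdn => //; [have := h1 0|have := h1 1]; rewrite !mxE.
Qed.

Variables (k : int) (a : 'M[R]_2 -> R[i]) (m : nat).
Hypothesis m_gt0 : (0 < m)%N.
Local Notation term := (index_term k a m).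

(** [b1] occurs only in [e(d1 b1 / m)]. On the support [m] divides [d1^2], so this is a character
    modulo [d1], trivial only if [m] divides [d1]. *)
Lemma sum_index_term_b1 (d1 d2 t b2 b4 : nat) : (0 < d1)%N -> (d1 %| m)%N ->
  \sum_(b1 < d1) term d1 d2 t b2 b4 b1 =
  if d1 == m then m%:R * term m d2 t b2 b4 0 else 0.
Proof.
move=> d10 d1m; rewrite /index_term.
set N := _ *: mx2 _ _ _ _; set q := (_ %/ d2)%N.
have [c0|c0] := eqVneq (coefficient a N) 0.
  rewrite big1 => [|b _]; last by rewrite c0 mul0r mulr0.
  by case: eqP => // e; move: c0; rewrite /N e => ->; rewrite mul0r !mulr0.
have [md _] := coefficient_gram_neq0 m_gt0 c0.
have E (b1 : nat) : (d1 * b1 + t * q + d2 * b4)%:R / m%:R =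
    (d1 * 0 + t * q + d2 * b4)%:R / m%:R + (d1 * b1)%:R / m%:R :> R[i].
  by rewrite -mulrDl -natrD; congr (_%:R / _); lia.
under eq_bigr do rewrite E expc2piD !mulrA.
rewrite -mulr_sumr expc2pi_sum_ord //.
have -> : (m %| d1)%N = (d1 == m).
  by apply/idP/eqP => [h|->//]; apply/eqP; rewrite eqn_dvd d1m.
case: eqP => [e|_]; last by rewrite mulr0.
by rewrite /N /q e mulrC -!mulrA.
Qed.

(** With [e = m / d] the lower-left entry of [B] is [e b2 + t b4], and modulo [m] the trace becomes
    [d (t^2 + 1) b4]. Hence [b2] contributes a plain factor [d], and [b4] a factor [d] together with
    the condition on [t]. *)
Lemma sum_index_term_b2_b4 (d t : nat) : (0 < d)%N -> (d %| m)%N ->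
  \sum_(b2 < d) \sum_(b4 < d) term m d (d * t) b2 b4 0 =
  if (m %/ d %| t ^ 2 + 1)%N then
    d%:R ^+ 2 * ((m * d)%:R ^ (- k) * coefficient a
     (d%:R *: mx2 (m %/ d)%:R t%:R t%:R ((t ^ 2 + 1) %/ (m %/ d))%:R))
  else 0.
Proof.
move=> d0 /dvdnP[e em]; have e0 : (0 < e)%N by move: m_gt0; rewrite em; lia.
have m0' : m%:R != 0 :> R by rewrite pnatr_eq0 -lt0n.
have -> : (m %/ d = e)%N by rewrite em mulnK.
rewrite /index_term; set N := _ *: mx2 _ _ _ _.
have eN (f : nat) : (t ^ 2 + 1 = f * e)%N ->
    d%:R *: mx2 e%:R t%:R t%:R f%:R = N.
  move=> ef; rewrite /N; apply: (scalerI m0').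
  rewrite !scalerA divff // !scale_mx2 -!natrM !mul1r.
  have -> : (m * d * e = m ^ 2)%N by rewrite em; ring.
  have -> : (m * d * t = m * (d * t))%N by rewrite mulnA.
  have -> // : (m * d * f = (d * t) ^ 2 + d ^ 2)%N.
  by rewrite expnMn -[X in (_ + X)%N]muln1 -mulnDr ef em; ring.
have E (b2 b4 : nat) : expc2pi ((m * 0 + d * t * ((m * b2 + d * t * b4) %/ d)
    + d * b4)%:R / m%:R) = expc2pi ((d * (t ^ 2 + 1) * b4)%:R / m%:R) :> R[i].
  have -> : ((m * b2 + d * t * b4) %/ d = e * b2 + t * b4)%N.
    rewrite em (_ : e * d * b2 + _ = (e * b2 + t * b4) * d)%N ?mulnK //; lia.
  have -> : (m * 0 + d * t * (e * b2 + t * b4) + d * b4 =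
    t * b2 * m + d * (t ^ 2 + 1) * b4)%N by rewrite em; ring.
  rewrite natrD mulrDl expc2piD natrM mulfK; last by rewrite pnatr_eq0 -lt0n.
  by rewrite [X in expc2pi X * _]pmulrn expc2pi_int mul1r.
under eq_bigr do under eq_bigr do rewrite E mulrA.
under eq_bigr do rewrite -mulr_sumr.
rewrite sumr_const card_ord.
have [c0|c0] := eqVneq (coefficient a N) 0.
  rewrite c0 mulr0 mul0r mul0rn; case: ifP => // /dvdnP[f ef].
  suff -> : d%:R *: mx2 e%:R t%:R t%:R ((t ^ 2 + 1) %/ e)%:R = N.
    by rewrite c0 !mulr0.
  by rewrite ef mulnK // (eN f).
have [_ md] := coefficient_gram_neq0 m_gt0 c0.
rewrite expc2pi_sum_ord //; last first.
  by move: md; rewrite (_ : (_ + _ = d * (d * (t ^ 2 + 1)))%N) //; ring.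
have -> : (m %| d * (t ^ 2 + 1))%N = (e %| t ^ 2 + 1)%N.
  by rewrite em mulnC dvdn_pmul2l.
case: ifP => [/dvdnP[f ef]|_]; last by rewrite mulr0 mul0rn.
have -> : d%:R *: mx2 e%:R t%:R t%:R ((t ^ 2 + 1) %/ e)%:R = N.
  by rewrite ef mulnK // (eN f).
by rewrite -mulr_natl; ring.
Qed.

End CharacterSums.

Definition root_count (e : nat) : nat := \sum_(t < e | (e %| t ^ 2 + 1)%N) 1.

(** For [d1 = m], integrality of [A] amounts to [d] dividing [t], and integrality of [B] then
    follows. *)
Lemma coset_index_top (m d t b1 b2 b4 : nat) : (0 < m)%N -> (d %| m)%N ->
  (b1 < m)%N -> coset_index m m d t b1 b2 b4 =
  [&& d %| t, t < m, b2 < d & b4 < d]%N.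
Proof.
move=> m0 /dvdnP[e em] bm; rewrite /coset_index dvdnn bm /= em dvdn_mull //=.
have d0 : (0 < d)%N by move: m0; rewrite em; lia.
have e0 : (0 < e)%N by move: m0; rewrite em; lia.
rewrite mulnK // dvdn_pmul2l //.
case: (boolP (d %| t)%N) => //= dt.
suff -> : (d %| e * d * b2 + t * b4)%N by [].
apply: dvdn_add; last exact: dvdn_mulr.
by rewrite -mulnA dvdn_mull // dvdn_mulr.
Qed.

Section Formula.
Variables (R : realType) (k : int) (F : 'M[R[i]]_2 -> R[i]).
Variables (a : 'M[R]_2 -> R[i]) (m : nat).
Hypothesis m_gt0 : (0 < m)%N.
Local Notation term := (index_term k a m).

Lemma sum_index_term_d1 (d1 d2 t b2 b4 : nat) : (d1 <= m)%N ->
  \sum_(b1 < m.+1) (if coset_index m d1 d2 t b1 b2 b4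
                    then term d1 d2 t b2 b4 b1 else 0) =
  if (d1 == m) && coset_index m m d2 t 0 b2 b4
  then m%:R * term m d2 t b2 b4 0 else 0.
Proof.
move=> d1m.
have E (b1 : nat) : coset_index m d1 d2 t b1 b2 b4 =
    coset_index m d1 d2 t 0 b2 b4 && (b1 < d1)%N.
  rewrite /coset_index; have [d10|d10] := posnP d1; last by lia.
  by rewrite d10 !ltn0 !andbF.
case: (boolP (coset_index m d1 d2 t 0 b2 b4)) => h; last first.
  rewrite big1 => [|b1 _]; last by rewrite E (negPf h).
  by case: eqP => // e; move: h; rewrite e => /negPf ->.
under eq_bigr do rewrite E h /=.
have /and5P[d1dvd _ _ _ /and4P[td _ _ _]] := h.
rewrite -big_mkcond /= big_ord_lt; last exact: leqW.
rewrite sum_index_term_b1 //; last exact: leq_trans td.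
by case: eqP => //= e; move: h; rewrite e => ->.
Qed.

Lemma sum_index_term_d (d : nat) : (d %| m)%N ->
  \sum_(t < m.+1) \sum_(b2 < m.+1) \sum_(b4 < m.+1)
    (if coset_index m m d t 0 b2 b4
     then m%:R * term m d t b2 b4 0 else 0) =
  m%:R * \sum_(t < m %/ d) \sum_(b2 < d) \sum_(b4 < d) term m d (d * t) b2 b4 0.
Proof.
move=> dm; have d0 : (0 < d)%N by exact: dvdn_gt0 dm.
have dlem : (d <= m)%N by exact: dvdn_leq.
pose f t := m%:R * \sum_(b2 < d) \sum_(b4 < d) term m d t b2 b4 0.
transitivity (\sum_(t < m.+1 | (t < m)%N) (if (d %| t)%N then f t else 0)).
  rewrite [RHS]big_mkcond; apply: eq_bigr => t _.
  under eq_bigr do under eq_bigr do rewrite coset_index_top //.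
  case: (boolP (t < m)%N) => tm; last first.
    by rewrite big1 // => b2 _; rewrite big1 // => b4 _; rewrite andbF.
  case: (boolP (d %| t)%N) => dt; last first.
    by rewrite big1 // => b2 _; rewrite big1.
  rewrite /f -(@big_ord_lt _ m.+1 d (fun b2 =>
    \sum_(b4 < d) term m d t b2 b4 0)); last exact: leqW.
  rewrite mulr_sumr [RHS]big_mkcond; apply: eq_bigr => b2 _ /=.
  case: ifP => _; last by rewrite big1.
  rewrite -(@big_ord_lt _ m.+1 d (fun b4 => term m d t b2 b4 0)); last exact: leqW.
  by rewrite mulr_sumr [RHS]big_mkcond.
rewrite (@big_ord_lt _ m.+1 m (fun t => if (d %| t)%N then f t else 0)) //.
rewrite -big_mkcond /= mulr_sumr -(@big_ord_multiples _ d (m %/ d) f) //.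
by rewrite [(d * _)%N]mulnC divnK.
Qed.

(** For [m = d e]: [m^(2k-3)] is the Hecke normalization, [m] comes from the sum over [b1], [d^2]
    from those over [b2] and [b4], and [(m d)^-k] from [det D]. The exponents of [d] add up to 0,
    those of [e] to [k - 2]. *)
Lemma power_normalization (d e : nat) : (0 < d)%N -> (0 < e)%N ->
  (d * e)%:R ^ (2 * k - 3) * ((d * e)%:R * (d%:R ^+ 2 * (d * e * d)%:R ^ (- k)))
  = e%:R ^ (k - 2) :> R[i].
Proof.
move=> d0 e0; rewrite !natrM.
have {d0} : d%:R != 0 :> R[i] by rewrite pnatr_eq0 -lt0n.
have {e0} : e%:R != 0 :> R[i] by rewrite pnatr_eq0 -lt0n.
move: (d%:R) (e%:R) => x y y0 x0.
have -> : y ^ (k - 2) = x ^ (2 * k - 3 + 1 + 2%:Z - k - k) *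
    y ^ (2 * k - 3 + 1 - k).
  rewrite (_ : 2 * k - 3 + 1 + 2%:Z - k - k = 0) ?expr0z ?mul1r; last by lia.
  by congr (y ^ _); lia.
rewrite !expfzMl !(expfzDr _ _ x0) !(expfzDr _ _ y0) !expr1z.
rewrite -[x ^ 2%:Z]/(x ^+ 2).
move: (x ^ (2 * k)) (y ^ (2 * k)) (x ^ (- k)) (y ^ (- k)) (x ^ (- 3)) (y ^ (- 3)).
move=> ? ? ? ? ? ?; ring.
Qed.

Theorem hecke_eigenvalue_formula :
  eigenform k F -> fourier_expansion a F -> a 1%:M = 1 ->
  hecke_eigenvalue k F m = \sum_(d <- divisors m)
    (root_count (m %/ d))%:R * (m %/ d)%:R ^ (k - 2) * a d%:R%:M.
Proof.
move=> Fe aF a1; have [Fk _ _] := Fe.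
rewrite (eigenvalue_sum Fe aF a1 m_gt0) big_mkcond !big_prod_type /=.
pose f (d1 d2 t b2 b4 : nat) : R[i] :=
  if (d1 == m) && coset_index m m d2 t 0 b2 b4
  then m%:R * term m d2 t b2 b4 0 else 0.
transitivity (m%:R ^ (2 * k - 3) * \sum_(d1 < m.+1) \sum_(d2 < m.+1)
    \sum_(t < m.+1) \sum_(b2 < m.+1) \sum_(b4 < m.+1) f d1 d2 t b2 b4).
  congr (_ * _); apply: eq_bigr => d1 _; apply: eq_bigr => d2 _.
  apply: eq_bigr => t _; apply: eq_bigr => b2 _; apply: eq_bigr => b4 _.
  exact: sum_index_term_d1 (ltn_ord d1).
rewrite (bigD1 (ord_max : 'I_m.+1)) //= [X in _ * (_ + X)]big1 ?addr0; last first.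
  move=> d1 /eqP d1m; do 4 (rewrite big1 // => ? _).
  rewrite /f; case: eqP => // e; case: d1m; exact: val_inj.
rewrite /f eqxx /= mulr_sumr.
pose g (d : nat) : R[i] :=
  (root_count (m %/ d))%:R * (m %/ d)%:R ^ (k - 2) * a d%:R%:M.
rewrite -(@big_ord_seq _ m.+1 (fun d => d %| m)%N _ g) ?divisors_uniq //;
  last first.
  move=> d; rewrite -dvdn_divisors //; case: (boolP (d %| m)%N) => dm.
    by rewrite andbT ltnS dvdn_leq.
  by rewrite andbF.
rewrite [RHS]big_mkcond; apply: eq_bigr => d _ /=.
case: (boolP (d %| m)%N) => dm; last first.
  do 3 (rewrite big1 ?mulr0 // => ? _).
  by rewrite /coset_index (negPf dm) andbF.
have d0 := dvdn_gt0 m_gt0 dm.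
rewrite sum_index_term_d // /g /root_count.
have e0 : (0 < m %/ d)%N by rewrite divn_gt0 // dvdn_leq.
have inner (t : nat) : \sum_(b2 < d) \sum_(b4 < d) term m d (d * t) b2 b4 0 =
    (if (m %/ d %| t ^ 2 + 1)%N then 1 else 0) *
    (d%:R ^+ 2 * ((m * d)%:R ^ (- k) * a d%:R%:M)).
  rewrite sum_index_term_b2_b4 //; case: ifP => [/dvdnP[q eq]|]; rewrite ?mul0r //.
  rewrite mul1r eq mulnK //; congr (_ * (_ * _)).
  (* [q] is the cofactor in [t^2 + 1 = q (m / d)], so the form has determinant one and positive last
     entry. *)
  have := @coefficient_unit_form _ _ _ _ Fk aF d (Posz (m %/ d)) (Posz t) (Posz q).
  rewrite -!pmulrn => ->; [|by move: eq; case: q => //; lia|by lia].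
  rewrite /coefficient ifT // inE; split.
    by rewrite scalar_mx2; have := half_integral_mx2 R d 0 d; rewrite mul0r.
  have -> : (d%:R%:M : 'M[R]_2) = d%:R *: (1%:M *m 1%:M^T).
    by rewrite trmx1 mulmx1 scalemx1.
  exact: possemidef_gram.
under eq_bigr do rewrite inner.
rewrite -mulr_suml -big_mkcond /= natr_sum.
rewrite mulrCA [X in _ * X]mulrA -(@power_normalization d (m %/ d)) //.
rewrite [(d * _)%N]mulnC divnK //; ring.
Qed.

End Formula.

(** * Square roots of -1 *)

Lemma root_count1 : root_count 1 = 1%N.
Proof. by rewrite /root_count big_mkcond big_ord1. Qed.

Lemma root_count_seq (q : nat) (s : seq nat) : uniq s ->
  (forall t, (t \in s) = (t < q)%N && (q %| t ^ 2 + 1)%N) ->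
  root_count q = size s.
Proof.
move=> us hs; rewrite /root_count.
rewrite (@big_ord_seq nat q (fun t => q %| t ^ 2 + 1)%N s (fun=> 1%N)) //.
exact: sum1_size.
Qed.

Lemma root_count2 : root_count 2 = 1%N.
Proof.
by apply: (@root_count_seq _ [:: 1%N]) => // -[|[|t]] //; rewrite !inE.
Qed.

Lemma root_count4 : root_count 4 = 0%N.
Proof.
by apply: (@root_count_seq _ [::]) => // -[|[|[|[|t]]]] //; rewrite !inE.
Qed.

Lemma dvdn_sqr_add1 (p t : nat) : prime p ->
  (p %| t ^ 2 + 1)%N = (t%:R ^+ 2 == -1 :> 'F_p).
Proof.
by move=> pp; rewrite (dvdn_pcharf (pchar_Fp pp)) natrD natrX addr_eq0.
Qed.

(** For [p = 4n + 3], a root [t] satisfies [t^p = t (t^2)^(2n+1) = -t], against Fermat's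
    [t^p = t]. *)
Lemma sqrt_minus1_none (p t : nat) : prime p -> (p %% 4 = 3)%N ->
  (p %| t ^ 2 + 1)%N = false.
Proof.
move=> pp p3; rewrite dvdn_sqr_add1 //; apply/negP => /eqP t2.
pose n := (p %/ 4)%N.
have pn : (p = (2 * (2 * n).+1).+1)%N by rewrite {1}(divn_eq p 4) p3 -/n; lia.
have := expf_card (t%:R : 'F_p); rewrite card_Fp // [in X in _ ^+ X]pn.
rewrite exprS exprM t2 exprS exprM sqrrN expr1n expr1n mulr1 mulrN1.
move=> /(congr1 ( *%R (t%:R))); rewrite mulrN -expr2 t2 opprK => /eqP.
rewrite -addr_eq0 -mulr2n -(dvdn_pcharf (pchar_Fp pp)) => /(dvdn_leq (ltn0Sn 1)).
by move: p3; case: p pp {t2 n pn} => [|[|[|p]]].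
Qed.

(** For [p = 4n + 1], Wilson's theorem gives [(4n)! = -1]. The upper [2n] factors are the negatives
    of the lower ones, and the signs cancel, so [(2n)!] is a root. *)
Lemma sqrt_minus1_exists (p : nat) : prime p -> (p %% 4 = 1)%N ->
  exists t, (p %| t ^ 2 + 1)%N.
Proof.
move=> pp p1; pose n := (p %/ 4)%N.
have pn : (p = (2 * n + 2 * n).+1)%N by rewrite {1}(divn_eq p 4) p1 -/n; lia.
have := pp; rewrite (Wilson (prime_gt1 pp)) {2}pn /=.
rewrite (dvdn_pcharf (pchar_Fp pp)) -natr1 addr_eq0.
rewrite -(@ffact_fact (2 * n + 2 * n) (2 * n)) ?leq_addr // addnK natrM.
move=> w; exists (2 * n)`!; rewrite dvdn_sqr_add1 //; move: w.
suff -> : ((2 * n + 2 * n) ^_ (2 * n))%:R = (2 * n)`!%:R :> 'F_p by rewrite expr2.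
rewrite ffact_prod fact_prod big_add1 /= big_mkord !natr_prod.
have E (i : 'I_(2 * n)) : (2 * n + 2 * n - i)%:R = - (i.+1)%:R :> 'F_p.
  apply/eqP; rewrite -addr_eq0 -natrD -(dvdn_pcharf (pchar_Fp pp)).
  by rewrite [X in (_ %| X)%N](_ : _ = p) //; have := ltn_ord i; lia.
under eq_bigr do rewrite E.
by rewrite prodrN card_ord exprM sqrrN expr1n expr1n mul1r.
Qed.

Lemma sqrt_minus1_lift (p s : nat) : prime p -> p != 2 ->
  (p %| s ^ 2 + 1)%N -> exists t, (p ^ 2 %| t ^ 2 + 1)%N.
Proof.
move=> pp p2 /dvdnP[c sc].
have ps : coprime (2 * s) p.
  rewrite coprime_sym prime_coprime // Euclid_dvdM // negb_or.
  rewrite dvdn_prime2 // p2 /=; apply/negP => ps.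
  have : (p %| 1)%N by rewrite -(@dvdn_addr (s ^ 2)) ?sc ?dvdn_mull // expnS dvdn_mulr.
  by rewrite dvdn1 => /eqP e; rewrite e in pp.
have [u [v uv]] := Bezoutz (2 * s)%N p.
have uv1 : u * (2 * s)%N%:Z + v * p%:Z = 1.
  by rewrite uv /gcdz /= (eqP ps).
(* A Newton step, u being an inverse of 2 s modulo p. *)
pose t : int := s%:Z - p%:Z * c%:Z * u.
have tp : ((p ^ 2)%N%:Z %| t * t + 1)%Z.
  apply/dvdzP; exists (c%:Z * v + c%:Z * c%:Z * u * u).
  have sc' : s%:Z * s%:Z + 1 = c%:Z * p%:Z by lia.
  have -> : t * t + 1 = (s%:Z * s%:Z + 1) - p%:Z * c%:Z * (u * (2 * s)%N%:Z)
     + p%:Z * p%:Z * (c%:Z * c%:Z * u * u).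
    by rewrite /t PoszM; ring.
  rewrite sc'.
  have -> : u * (2 * s)%N%:Z = 1 - v * p%:Z by rewrite -uv1 addrK.
  by rewrite expnS expn1 PoszM; ring.
exists (absz t); move: tp; rewrite dvdzE /=.
by rewrite (_ : absz (t * t + 1) = (absz t ^ 2 + 1)%N) //; lia.
Qed.

(** The coprimality hypothesis lets [q] be [p] or [p^2] alike. If [s] is one root, any root [x] has
    [q] dividing [(x + s)(x - s)]; [p] cannot divide both factors since it does not divide [2 s], so
    [q] divides one of them and [x] is [s] or [q - s]. *)
Lemma root_count_two (p q t : nat) : prime p -> p != 2 -> (0 < q)%N ->
  (p %| q)%N -> (forall y, ~~ (p %| y)%N -> coprime q y) ->
  (q %| t ^ 2 + 1)%N -> root_count q = 2.
Proof.
move=> pp p2 q0 pq cop ht.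
pose s := (t %% q)%N; have sq : (s < q)%N by rewrite ltn_mod.
have hs : (q %| s ^ 2 + 1)%N by rewrite /dvdn -modnDml modnXm modnDml.
have ps : ~~ (p %| s)%N.
  apply/negP => ps; have := dvdn_trans pq hs.
  rewrite dvdn_addr; last by rewrite expnS dvdn_mulr.
  by rewrite dvdn1 => /eqP e; rewrite e in pp.
move: (s) sq hs ps => {t ht} {}s sq hs ps.
have s0 : (0 < s)%N by rewrite lt0n; apply: contra ps => /eqP ->; rewrite dvdn0.
have p2s : ~~ (p %| 2 * s)%N by rewrite Euclid_dvdM // negb_or dvdn_prime2 // p2.
have er : (q = (q - s) + s)%N by rewrite subnK // ltnW.
move: (q - s)%N er => r er.
apply: (@root_count_seq _ [:: s; r]) => [|x].
  rewrite /= inE andbT; apply: contra p2s => /eqP e.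
  by rewrite mul2n -addnn {1}e -er.
rewrite !inE; apply/orP/andP => [[/eqP ->|/eqP ->]|[xq hx]].
- by [].
- split; first by rewrite er -[X in (X < _)%N]addn0 ltn_add2l.
  (* As [r = q - s], adding [2 s q] turns [r^2 + 1] into [q^2 + s^2 + 1], with no subtraction in
     [nat]. *)
  rewrite -(@dvdn_addr (2 * s * q)) ?dvdn_mull //.
  rewrite [X in (_ %| X)%N](_ : _ = q * q + (s ^ 2 + 1))%N.
    by rewrite dvdn_add // dvdn_mulr.
  by rewrite er; ring.
have h : (q%:Z %| (x%:Z + s%:Z) * (x%:Z - s%:Z))%Z.
  have /dvdnP[c1 e1] := hs; have /dvdnP[c2 e2] := hx.
  apply/dvdzP; exists (c2%:Z - c1%:Z).
  have e1' : s%:Z * s%:Z + 1 = c1%:Z * q%:Z by clear -e1; lia.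
  have e2' : x%:Z * x%:Z + 1 = c2%:Z * q%:Z by clear -e2; lia.
  by rewrite mulrBl -e1' -e2'; ring.
have {}cop (y : int) : ~~ (p %| `|y|)%N -> coprimez q%:Z y.
  by move=> py; rewrite coprimezE cop.
have [pxs|pxs] := boolP (p %| x + s)%N.
  have pd : ~~ (p %| `|x%:Z - s%:Z|)%N.
    apply: contra p2s => pd.
    have : (p%:Z %| (x + s)%N%:Z - (x%:Z - s%:Z))%Z by rewrite rpredB // dvdzE.
    rewrite (_ : _ - _ = (2 * s)%N%:Z) //; clear; lia.
  move: h; rewrite mulrC Gauss_dvdzr ?cop // => /dvdzP[c ec].
  (* [x + s] lies strictly between 0 and [2 q], so the only possible multiple of [q] is [q]. *)
  right; apply/eqP; have c1 : c = 1 by clear -ec xq sq s0; nia.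
  by move: ec; rewrite c1 er; clear; lia.
move: h; rewrite Gauss_dvdzr ?cop // => /dvdzP[c ec]; left; apply/eqP.
have /(_ q%:Z (x%:Z - s%:Z) c) := multiple_small.
by clear -ec xq sq; lia.
Qed.

Lemma root_count_prime (p : nat) : prime p ->
  root_count p = h1 p /\ root_count (p ^ 2) = h2 p.
Proof.
move=> pp; have [->|p2] := eqVneq p 2.
  by rewrite root_count2 root_count4.
rewrite /h1 /h2 (negPf p2).
have [p1|p3] : (p %% 4 = 1)%N \/ (p %% 4 = 3)%N.
  by have := even_prime pp; case=> [|op]; [move/eqP: p2|lia].
- rewrite p1 /=; have [t ht] := sqrt_minus1_exists pp p1.
  have [t' ht'] := sqrt_minus1_lift pp p2 ht.
  split.
    apply: (root_count_two pp p2 _ _ _ ht) => [||y]; rewrite ?prime_gt0 //.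
    by rewrite prime_coprime.
  apply: (root_count_two pp p2 _ _ _ ht') => [||y].
  - by rewrite expn_gt0 prime_gt0.
  - exact: dvdn_exp.
  - by move=> py; rewrite coprimeXl // prime_coprime.
- rewrite p3 /=; split; rewrite /root_count big1 // => t.
    by rewrite sqrt_minus1_none.
  move=> /(dvdn_trans (dvdn_exp (ltn0Sn 1) (dvdnn p))).
  by rewrite sqrt_minus1_none.
Qed.

Theorem theorem1p2 (R : realType) (k : int) (F : 'M[R[i]]_2 -> R[i])
    (a : 'M[R]_2 -> R[i]) :
  eigenform k F ->
  fourier_expansion a F ->
  a 1%:M = 1 ->
  forall p : nat, prime p ->
    hecke_eigenvalue k F p
      = a p%:R%:M + (h1 p)%:R * p%:R ^ (k - 2)
    /\
    hecke_eigenvalue k F (p ^ 2)%N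
      = a (p ^ 2)%:R%:M + (h1 p)%:R * p%:R ^ (k - 2) * a p%:R%:M
        + (h2 p)%:R * p%:R ^ (2 * k - 4).
Proof.
move=> Fe aF a1 p pp; have [c1 c2] := root_count_prime pp.
have p0 := prime_gt0 pp; have p1 := prime_gt1 pp.
have div1 : perm_eq (divisors p) [:: 1; p]%N.
  apply: uniq_perm; rewrite ?divisors_uniq //=; first by rewrite inE; lia.
  move=> d; rewrite -dvdn_divisors // !inE.
  rewrite -[p in (_ %| p)%N]expn1.
  apply/(dvdn_pfactor _ _ pp)/orP => [[[|[|//]] _ ->]|].
  - by left.
  - by right; rewrite expn1.
  by case=> /eqP ->; [exists 0%N|exists 1%N; rewrite ?expn1].
have div2 : perm_eq (divisors (p ^ 2)) [:: 1; p; p ^ 2]%N.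
  apply: uniq_perm; rewrite ?divisors_uniq //=; first by rewrite !inE; nia.
  move=> d; rewrite -dvdn_divisors ?expn_gt0 ?p0 // !inE.
  apply/(dvdn_pfactor _ _ pp)/or3P => [[[|[|[|//]]] _ ->]|].
  - by constructor 1.
  - by constructor 2; rewrite expn1.
  - by constructor 3.
  by case=> /eqP ->; [exists 0%N|exists 1%N; rewrite ?expn1|exists 2%N].
have dp : (p ^ 2 %/ p = p)%N by rewrite expnS expn1 mulnK.
have ep : p%:R ^ (2 * k - 4) = (p ^ 2)%:R ^ (k - 2) :> R[i].
  have -> : 2 * k - 4 = 2%:Z * (k - 2) by lia.
  by rewrite natrX -exprz_exp.
(* The divisor [d = 1] gives the terms free of [a], through [a(I) = 1]; [d = m] gives [a(m I)] with
   factor [root_count 1 = 1]; [d = p] in [p^2] gives the mixed term. *)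
rewrite !(hecke_eigenvalue_formula _ Fe aF a1) ?expn_gt0 ?p0 //.
rewrite (perm_big _ div1) (perm_big _ div2) !big_cons !big_nil /=.
rewrite !divn1 dp !divnn expn_gt0 p0 /= root_count1 c1 c2 ep.
by rewrite a1 !exp1rz; split; ring.
Qed.
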